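(* Let $p$ be an odd prime and $B_p$ the quaternion algebra over $\mathbb{Q}$ ramified exactly at $p$ and $\infty$. Suppose $\mathcal{O}_1,\mathcal{O}_2$ are orders of $B_p$, each of index $r$ in some (not necessarily the same) maximal order of $B_p$. Suppose the Gross lattices $\mathcal{O}_1^T$ and $\mathcal{O}_2^T$ have the same successive minima $D_1\le D_2\le D_3$, and that $D_1\ge 8r^2$. Then $\mathcal{O}_1\simeq\mathcal{O}_2$.
   Context: On $B_p$ let $\overline{x}$ be the canonical involution, $N(x)=x\overline{x}$ the reduced norm, $\mathrm{Tr}(x)=x+\overline{x}$ the reduced trace. For an order $\mathcal{O}$, its Gross lattice is $\mathcal{O}^T=\{2x-\mathrm{Tr}(x):x\in\mathcal{O}\}$, a rank-$3$ lattice with the positive definite quadratic form $N$. Successive minima (non-standard normalization): for a lattice $\Lambda$ of rank $k$ with positive definite quadratic form $Q$ and $1\le i\le k$, the $i$-th successive minimum is the minimum value $D_i$ such that the $\mathbb{Z}$-module generated by $\{v\in\Lambda: Q(v)\le D_i\}$ has rank at least $i$. *)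

(* Defs.v *)
From HB Require Import structures.
From mathcomp Require Import all_boot all_order all_algebra.
Set Implicit Arguments. Unset Strict Implicit. Unset Printing Implicit Defensive.
Import Order.TTheory GRing.Theory Num.Theory.
Local Open Scope ring_scope.

(* The quaternion algebra (a,b)_Q with a, b nonzero integers, modelled on
   'rV[rat]_4 : x = x0 + x1 i + x2 j + x3 k,  i^2 = a, j^2 = b, k = ij = -ji. *)
Definition quat := 'rV[rat]_4.

Definition q0 : 'I_4 := @Ordinal 4 0 isT.
Definition q1 : 'I_4 := @Ordinal 4 1 isT.
Definition q2 : 'I_4 := @Ordinal 4 2 isT.
Definition q3 : 'I_4 := @Ordinal 4 3 isT.

Definition mkq (x0 x1 x2 x3 : rat) : quat :=
  \row_(t < 4) [:: x0; x1; x2; x3]`_t.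

Definition qone : quat := mkq 1 0 0 0.

Definition qmul (a b : int) (x y : quat) : quat :=
  let A := (a%:~R : rat) in let B := (b%:~R : rat) in
  mkq (x 0 q0 * y 0 q0 + A * x 0 q1 * y 0 q1 + B * x 0 q2 * y 0 q2
         - A * B * x 0 q3 * y 0 q3)
      (x 0 q0 * y 0 q1 + x 0 q1 * y 0 q0 - B * x 0 q2 * y 0 q3
         + B * x 0 q3 * y 0 q2)
      (x 0 q0 * y 0 q2 + x 0 q2 * y 0 q0 + A * x 0 q1 * y 0 q3
         - A * x 0 q3 * y 0 q1)
      (x 0 q0 * y 0 q3 + x 0 q3 * y 0 q0 + x 0 q1 * y 0 q2
         - x 0 q2 * y 0 q1).

Definition qconj (x : quat) : quat := mkq (x 0 q0) (- x 0 q1) (- x 0 q2) (- x 0 q3).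
Definition qtr (x : quat) : rat := x 0 q0 + (qconj x) 0 q0.
Definition qnorm (a b : int) (x : quat) : rat := (qmul a b x (qconj x)) 0 q0.

Definition inorm (a b : int) (v0 v1 v2 v3 : int) : int :=
  v0 ^+ 2 - a * v1 ^+ 2 - b * v2 ^+ 2 + a * b * v3 ^+ 2.

(* (a,b) splits at the prime l iff the norm form is isotropic over Q_l, i.e.
   (by compactness of the primitive vectors of Z_l^4) iff for every k it has a
   primitive zero modulo l^k. *)
Definition split_at (a b : int) (l : nat) : Prop :=
  forall k : nat, exists v0 v1 v2 v3 : int,
    ~~ [&& (l%:Z %| v0)%Z, (l%:Z %| v1)%Z, (l%:Z %| v2)%Z & (l%:Z %| v3)%Z] /\
    ((l%:Z ^+ k) %| inorm a b v0 v1 v2 v3)%Z.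

(* (a,b)_Q is ramified at infinity iff a < 0 and b < 0 (definite). *)
Definition ramified_exactly_at_p_infty (a b : int) (p : nat) : Prop :=
  a < 0 /\ b < 0 /\ (forall l : nat, prime l -> (~ split_at a b l <-> l = p)).

Definition lat (M : 'M[rat]_4) (v : quat) : Prop :=
  exists z : 'rV[int]_4, v = map_mx (fun t : int => t%:~R) z *m M.

Definition subset_q (S T : quat -> Prop) : Prop := forall v, S v -> T v.

Definition is_order (a b : int) (M : 'M[rat]_4) : Prop :=
  M \in unitmx /\ lat M qone /\
  (forall x y, lat M x -> lat M y -> lat M (qmul a b x y)).

Definition is_max_order (a b : int) (M : 'M[rat]_4) : Prop :=
  is_order a b M /\
  (forall M', is_order a b M' -> subset_q (lat M) (lat M') -> subset_q (lat M') (lat M)).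

Definition index_is (S T : quat -> Prop) (r : nat) : Prop :=
  subset_q S T /\
  exists s : seq quat,
    size s = r /\ (forall i, (i < r)%N -> T (nth 0 s i)) /\
    (forall i j, (i < r)%N -> (j < r)%N -> i <> j -> ~ S (nth 0 s i - nth 0 s j)) /\
    (forall y, T y -> exists2 i, (i < r)%N & S (y - nth 0 s i)).

Definition gross (O : quat -> Prop) (v : quat) : Prop :=
  exists x, O x /\ v = 2%:R *: x - qtr x *: qone.

Definition span_rank_ge (S : quat -> Prop) (i : nat) : Prop :=
  exists f : 'I_i -> quat, (forall t, S (f t)) /\ row_free (\matrix_(t < i) f t).

Definition succ_min (a b : int) (Lam : quat -> Prop) (i : nat) (D : rat) : Prop :=
  let P := fun E : rat => span_rank_ge (fun v => Lam v /\ qnorm a b v <= E) i in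
  P D /\ (forall E, P E -> D <= E).

Definition orders_iso (a b : int) (O1 O2 : quat -> Prop) : Prop :=
  exists f : quat -> quat,
    (forall x, O1 x -> O2 (f x)) /\
    (forall y, O2 y -> exists x, O1 x /\ f x = y) /\
    (forall x y, O1 x -> O1 y -> f x = f y -> x = y) /\
    (forall x y, O1 x -> O1 y -> f (x + y) = f x + f y) /\
    (forall x y, O1 x -> O1 y -> f (qmul a b x y) = qmul a b (f x) (f y)) /\
    f qone = qone.

(* Main.v *)
Require Import Defs.
From HB Require Import structures.
From mathcomp Require Import all_boot all_order all_algebra.
From mathcomp Require Import ring lra zify.
From Stdlib Require Import Classical.
Set Implicit Arguments. Unset Strict Implicit. Unset Printing Implicit Defensive.
Import Order.TTheory GRing.Theory Num.Theory.
Local Open Scope ring_scope.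

(* An order O has a reduced discriminant N(O) = 4ab det(1, x, y, z), and N(O) divides nrd[x, y] for all x, y in O.
   A maximal order has N = p: an order with N divisible by l is the even Clifford algebra of an integral ternary form
   degenerate modulo l, and such a form can be enlarged unless it is a plane anisotropic modulo l plus l times a unit,
   in which case the norm form is anisotropic at l; conversely, if p does not divide N, Hensel lifting makes the norm
   form isotropic at p.  Hence N(O_i) = p r up to sign.

   In rank three, vectors attaining the successive minima form a basis v_1, v_2, v_3 of the Gross lattice
   (nearest-plane rounding), with 2 |<v_i, v_j>| <= D_min(i,j), Gram determinant 4 p^2 r^2 and
   3 D1 D2 D3 <= 8 * 4 p^2 r^2.  With D1 >= 8 r^2 this gives D2 < 2 p.  As D_i D_j - <v_i, v_j>^2 = 4 nrd[x_i, x_j] is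
   divisible by 4 p, each <v_i, v_j> is determined up to sign, and the determinant fixes the sign of the product of the
   three.  So the two Gross lattices are isometric by a map of determinant 1, which preserves the cross product and
   extends to a ring isomorphism of the orders. *)

(** * Quaternions and lattices *)

(** Orders are not enlarged by adjoining elements, since closure under multiplication would have to
    be checked each time. An order is placed inside the even Clifford order of a ternary lattice and
    the lattice is changed instead: closure is then automatic, only six coefficients must stay
    integral, and the discriminant of the form measures the gain. Working with the half-discriminant
    and the cross coefficients, instead of a Gram matrix with halves, keeps this valid at l = 2. No
    completions occur: anisotropy at l is a congruence statement on integer vectors, so moving it
    between lattices requires control of denominators. The bound 2p fits the comparison exactly: two
    candidates for an inner product have squares equal modulo 4p, so they agree up to sign modulo
    2p, and both have absolute value below p. Inner products are bounded by [D1] and [D2] alone, so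
    [D3] need not be compared with p. *)

Lemma quatP (x y : quat) :
  x 0 q0 = y 0 q0 -> x 0 q1 = y 0 q1 -> x 0 q2 = y 0 q2 -> x 0 q3 = y 0 q3 ->
  x = y.
Proof.
move=> h0 h1 h2 h3; apply/rowP => i.
by case: i => [[|[|[|[|//]]]] hi];
  [have -> : Ordinal hi = q0 by exact: val_inj | have -> : Ordinal hi = q1 by exact: val_inj
  |have -> : Ordinal hi = q2 by exact: val_inj | have -> : Ordinal hi = q3 by exact: val_inj].
Qed.

Lemma mkqE (x0 x1 x2 x3 : rat) :
  (((mkq x0 x1 x2 x3) 0 q0 = x0) * ((mkq x0 x1 x2 x3) 0 q1 = x1) *
  ((mkq x0 x1 x2 x3) 0 q2 = x2) * ((mkq x0 x1 x2 x3) 0 q3 = x3))%type.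
Proof. by rewrite !mxE. Qed.

Lemma addqE (x y : quat) i : (x + y) 0 i = x 0 i + y 0 i. Proof. exact: mxE. Qed.
Lemma oppqE (x : quat) i : (- x) 0 i = - x 0 i. Proof. exact: mxE. Qed.
Lemma scaleqE c (x : quat) i : (c *: x) 0 i = c * x 0 i. Proof. exact: mxE. Qed.
Lemma zeroqE i : (0 : quat) 0 i = 0. Proof. exact: mxE. Qed.

(** Half the reduced trace of [x] times the conjugate of [y]. On an order only its double is
    guaranteed to be integral, hence the recurring factor 2. *)
Definition qdot (a b : int) (x y : quat) : rat :=
  x 0 q0 * y 0 q0 - a%:~R * (x 0 q1 * y 0 q1) - b%:~R * (x 0 q2 * y 0 q2)
  + a%:~R * b%:~R * (x 0 q3 * y 0 q3).

(** Determinant of the pure coordinates, equal to det(1, x, y, z). Up to sign, 4ab times it is the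
    reduced discriminant of an order with basis 1, x, y, z. *)
Definition vol (x y z : quat) : rat :=
  x 0 q1 * (y 0 q2 * z 0 q3 - y 0 q3 * z 0 q2)
  - x 0 q2 * (y 0 q1 * z 0 q3 - y 0 q3 * z 0 q1)
  + x 0 q3 * (y 0 q1 * z 0 q2 - y 0 q2 * z 0 q1).

Definition qcom (a b : int) (x y : quat) : quat := qmul a b x y - qmul a b y x.

Definition qmat (x y z w : quat) : 'M[rat]_4 :=
  \matrix_(t < 4) [:: x; y; z; w]`_t.

Definition qE := (mkqE, addqE, oppqE, scaleqE, zeroqE).

Ltac qsimp :=
  rewrite ?/qcom ?/qmul ?/qnorm ?/qdot ?/vol ?/qtr ?/qconj ?/qone ?qE.
Ltac qring := apply: quatP; qsimp; ring.

Lemma qnorm_dot a b x : qnorm a b x = qdot a b x x.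
Proof. rewrite /qnorm /qmul /qconj /qdot ?qE; ring. Qed.

Lemma qnormE a b x : qnorm a b x = x 0 q0 ^+ 2 - a%:~R * x 0 q1 ^+ 2
  - b%:~R * x 0 q2 ^+ 2 + a%:~R * b%:~R * x 0 q3 ^+ 2.
Proof. rewrite qnorm_dot /qdot; ring. Qed.

Lemma qnormM a b x y : qnorm a b (qmul a b x y) = qnorm a b x * qnorm a b y.
Proof. rewrite !qnormE /qmul ?qE; ring. Qed.

Lemma sum4 (V : nmodType) (F : 'I_4 -> V) : \sum_(i < 4) F i = F q0 + F q1 + F q2 + F q3.
Proof.
rewrite !big_ord_recl big_ord0 addr0 !addrA.
by congr (_ + _ + _ + _); congr F; apply: val_inj.
Qed.

Lemma qmatE x y z w j : (((qmat x y z w) q0 j = x 0 j) * ((qmat x y z w) q1 j = y 0 j) *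
  ((qmat x y z w) q2 j = z 0 j) * ((qmat x y z w) q3 j = w 0 j))%type.
Proof. by rewrite !mxE. Qed.

Definition o0 : 'I_3 := @Ordinal 3 0 isT.
Definition o1 : 'I_3 := @Ordinal 3 1 isT.
Definition o2 : 'I_3 := @Ordinal 3 2 isT.

Lemma det3E (R : comNzRingType) (A : 'M[R]_3) : \det A =
  A o0 o0 * (A o1 o1 * A o2 o2 - A o1 o2 * A o2 o1)
  - A o0 o1 * (A o1 o0 * A o2 o2 - A o1 o2 * A o2 o0)
  + A o0 o2 * (A o1 o0 * A o2 o1 - A o1 o1 * A o2 o0).
Proof.
(* The expansions produce ordinals with different bound proofs; indexing by [nat] makes equal
   entries syntactically equal for [ring]. *)
pose B (i j : nat) := A (inord i) (inord j).
have BE i j : A i j = B i j by rewrite /B !inord_val.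
rewrite (expand_det_row _ ord0) !big_ord_recl big_ord0.
rewrite /cofactor !(expand_det_row _ ord0) !big_ord_recl !big_ord0.
rewrite /cofactor !det_mx11 !mxE !BE /= /bump /=.
by rewrite !expr0 !expr1 /= ; ring.
Qed.

Lemma det4E (R : comNzRingType) (A : 'M[R]_4) : \det A =
  A q0 q0 * (A q1 q1 * (A q2 q2 * A q3 q3 - A q2 q3 * A q3 q2)
           - A q1 q2 * (A q2 q1 * A q3 q3 - A q2 q3 * A q3 q1)
           + A q1 q3 * (A q2 q1 * A q3 q2 - A q2 q2 * A q3 q1))
  - A q0 q1 * (A q1 q0 * (A q2 q2 * A q3 q3 - A q2 q3 * A q3 q2)
           - A q1 q2 * (A q2 q0 * A q3 q3 - A q2 q3 * A q3 q0)
           + A q1 q3 * (A q2 q0 * A q3 q2 - A q2 q2 * A q3 q0))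
  + A q0 q2 * (A q1 q0 * (A q2 q1 * A q3 q3 - A q2 q3 * A q3 q1)
           - A q1 q1 * (A q2 q0 * A q3 q3 - A q2 q3 * A q3 q0)
           + A q1 q3 * (A q2 q0 * A q3 q1 - A q2 q1 * A q3 q0))
  - A q0 q3 * (A q1 q0 * (A q2 q1 * A q3 q2 - A q2 q2 * A q3 q1)
           - A q1 q1 * (A q2 q0 * A q3 q2 - A q2 q2 * A q3 q0)
           + A q1 q2 * (A q2 q0 * A q3 q1 - A q2 q1 * A q3 q0)).
Proof.
pose B (i j : nat) := A (inord i) (inord j).
have BE i j : A i j = B i j by rewrite /B !inord_val.
rewrite (expand_det_row _ ord0) !big_ord_recl big_ord0.
rewrite /cofactor !det3E !mxE !BE /= /bump /=.
by rewrite !exprS !expr0 /= ; ring.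
Qed.

Lemma det_qmat1 x y z : \det (qmat qone x y z) = vol x y z.
Proof. by rewrite det4E !qmatE /qone ?qE /vol; ring. Qed.

(** Triple product rule. Pairing with [x, y] kills 1, x and y, so on an element written in the basis
    1, x, y, z it reads off the z-coordinate times the discriminant. Every divisibility by the
    reduced discriminant comes from this. *)
Lemma qcom_dot a b x y z :
  2%:R * qdot a b (qcom a b x y) z = 4%:R * a%:~R * b%:~R * vol x y z.
Proof. qsimp; ring. Qed.

Lemma lat0 M : lat M 0.
Proof. by exists 0; rewrite map_mx0 mul0mx. Qed.

Lemma latD M x y : lat M x -> lat M y -> lat M (x + y).
Proof. by case=> z -> [w ->]; exists (z + w); rewrite map_mxD mulmxDl. Qed.

Lemma latZ M (n : int) x : lat M x -> lat M (n%:~R *: x).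
Proof. by case=> z ->; exists (n *: z); rewrite map_mxZ scalemxAl. Qed.

Lemma latN M x : lat M x -> lat M (- x).
Proof. by move=> h; rewrite -scaleN1r -(rmorphN1 (intr : int -> rat)); apply: latZ. Qed.

Lemma latB M x y : lat M x -> lat M y -> lat M (x - y).
Proof. by move=> hx hy; apply: latD => //; apply: latN. Qed.

Lemma latZint M (c : rat) x : c \is a Num.int -> lat M x -> lat M (c *: x).
Proof. by case/intrP=> n -> ; apply: latZ. Qed.

Lemma lat_sub M1 M2 : (forall i, lat M2 (row i M1)) -> subset_q (lat M1) (lat M2).
Proof.
move=> h v [z ->]; rewrite mulmx_sum_row.
elim/big_ind: _ => [|x y|i _]; [exact: lat0|exact: latD|].
by rewrite mxE; apply: latZ.
Qed.

Lemma row_qmat x y z w : ((row q0 (qmat x y z w) = x) * (row q1 (qmat x y z w) = y) *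
  (row q2 (qmat x y z w) = z) * (row q3 (qmat x y z w) = w))%type.
Proof. by rewrite !rowK. Qed.

Lemma row4P (P : 'I_4 -> Prop) : P q0 -> P q1 -> P q2 -> P q3 -> forall i, P i.
Proof.
move=> h0 h1 h2 h3 i.
by case: i => [[|[|[|[|//]]]] hi];
  [have -> : Ordinal hi = q0 by exact: val_inj | have -> : Ordinal hi = q1 by exact: val_inj
  |have -> : Ordinal hi = q2 by exact: val_inj | have -> : Ordinal hi = q3 by exact: val_inj].
Qed.

Lemma lat_row M i : lat M (row i M).
Proof.
exists (delta_mx 0 i); rewrite rowE; congr (_ *m _).
by apply/matrixP => s t; rewrite !mxE; case: (_ && _).
Qed.

Lemma lat_qmatP x y z w v : lat (qmat x y z w) v <->
  exists n0 n1 n2 n3 : int, v = n0%:~R *: x + n1%:~R *: y + n2%:~R *: z + n3%:~R *: w.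
Proof.
split=> [[n ->]|[n0] [n1] [n2] [n3] ->].
  exists (n 0 q0), (n 0 q1), (n 0 q2), (n 0 q3).
  by rewrite mulmx_sum_row sum4 !mxE !row_qmat.
by do !apply: latD; apply: latZ;
   [have := lat_row (qmat x y z w) q0|have := lat_row (qmat x y z w) q1
   |have := lat_row (qmat x y z w) q2|have := lat_row (qmat x y z w) q3]; rewrite row_qmat.
Qed.

Lemma lat_subset_mx M1 M2 : subset_q (lat M1) (lat M2) ->
  exists Z : 'M[int]_4, M1 = map_mx intr Z *m M2.
Proof.
move=> h; have {}h i : exists z : 'rV[int]_4, row i M1 = map_mx intr z *m M2.
  exact: h (lat_row _ _).
have [f hf] := fin_all_exists h.
exists (\matrix_i f i); apply/row_matrixP => i; rewrite hf row_mul; congr (_ *m _).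
by apply/rowP => j; rewrite !mxE.
Qed.

Lemma det_intr (n : nat) (Z : 'M[int]_n) : \det (map_mx intr Z) = (\det Z)%:~R :> rat.
Proof. exact: det_map_mx. Qed.

Lemma lat_eq_det M1 M2 : M1 \in unitmx -> subset_q (lat M1) (lat M2) ->
  subset_q (lat M2) (lat M1) -> `|\det M1| = `|\det M2|.
Proof.
move=> u1 /lat_subset_mx [Z e1] /lat_subset_mx [W e2].
have d1 : \det M1 != 0 by rewrite -unitfE -unitmxE.
have e : \det M1 = (\det Z * \det W)%:~R * \det M1.
  by rewrite {1}e1 {1}e2 !det_mulmx !det_intr rmorphM /= mulrA.
have : (\det Z * \det W)%:~R = 1 :> rat.
  by apply: (mulIf d1); rewrite mul1r -e.
rewrite -[1]/(1%:~R) => /eqP; rewrite eqr_int => /eqP zw.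
have nz : `|\det Z| = 1.
  have /eqP := congr1 absz zw; rewrite abszM muln_eq1 => /andP[/eqP h _].
  by rewrite -abszE h.
by rewrite e1 det_mulmx normrM det_intr -intr_norm nz mul1r.
Qed.

Lemma rintD (x y : rat) : x \is a Num.int -> y \is a Num.int -> x + y \is a Num.int.
Proof. exact: rpredD. Qed.
Lemma rintB (x y : rat) : x \is a Num.int -> y \is a Num.int -> x - y \is a Num.int.
Proof. exact: rpredB. Qed.
Lemma rintM (x y : rat) : x \is a Num.int -> y \is a Num.int -> x * y \is a Num.int.
Proof. exact: rpredM. Qed.
Lemma rintX (x : rat) n : x \is a Num.int -> x ^+ n \is a Num.int.
Proof. exact: rpredX. Qed.
Lemma rint_nat n : n%:R \is a @Num.int rat.
Proof. exact: rpred_nat. Qed.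

(** * Orders *)

Lemma rat_sqr_int (c : rat) : c ^+ 2 \is a Num.int -> c \is a Num.int.
Proof.
case/intrP => m hm; rewrite Qint_def.
have hd : (denq c)%:~R != 0 :> rat by rewrite intr_eq0 denq_neq0.
have e : (numq c) ^+ 2 = m * (denq c) ^+ 2.
  apply/eqP; rewrite -(eqr_int rat) [X in _ == X]intrM !rmorphXn /= -hm.
  by rewrite -[X in _ == X ^+ 2 * _]divq_num_den exprMn exprVn mulfVK // expf_neq0.
have h : (`|denq c| %| `|numq c| ^ 2)%N.
  by rewrite -abszX e abszM abszX dvdn_mull // expnS dvdn_mulr.
have := coprime_num_den c; rewrite coprime_sym => hc.
have : (`|denq c| %| 1)%N by rewrite -(Gauss_dvdr 1 (coprimeXr 2 hc)) muln1.
by rewrite dvdn1 => /eqP h1; rewrite -[denq c]gez0_abs ?denq_ge0 // h1.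
Qed.

Lemma qmulDl a b x y z : qmul a b (x + y) z = qmul a b x z + qmul a b y z.
Proof. qring. Qed.
Lemma qmulDr a b x y z : qmul a b x (y + z) = qmul a b x y + qmul a b x z.
Proof. qring. Qed.
Lemma qmulZl a b c x z : qmul a b (c *: x) z = c *: qmul a b x z.
Proof. qring. Qed.
Lemma qmulZr a b c x z : qmul a b x (c *: z) = c *: qmul a b x z.
Proof. qring. Qed.

Definition qlmul (a b : int) (x : quat) : 'M[rat]_4 :=
  qmat (qmul a b x (mkq 1 0 0 0)) (qmul a b x (mkq 0 1 0 0))
       (qmul a b x (mkq 0 0 1 0)) (qmul a b x (mkq 0 0 0 1)).

Lemma mul_qlmul a b x y : y *m qlmul a b x = qmul a b x y.
Proof. by rewrite mulmx_sum_row sum4 !row_qmat; qring. Qed.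

Lemma det_qlmul a b x : \det (qlmul a b x) = qnorm a b x ^+ 2.
Proof. rewrite det4E !qmatE qnormE; qsimp; ring. Qed.

Section Order.
Context {a b : int} {M : 'M[rat]_4} (oM : is_order a b M).

Let uM : M \in unitmx. Proof. by case: oM. Qed.
Let one_in : lat M qone. Proof. by case: oM => _ []. Qed.
Let mul_in x y : lat M x -> lat M y -> lat M (qmul a b x y).
Proof. by case: oM => _ [_]; apply. Qed.
Let det_neq0 : \det M != 0. Proof. by rewrite -unitfE -unitmxE. Qed.

(* Left multiplication by x preserves the lattice and has determinant nrd(x)^2. *)
Lemma order_norm_int x : lat M x -> qnorm a b x \is a Num.int.
Proof.
move=> hx; apply: rat_sqr_int; rewrite -det_qlmul.
have /lat_subset_mx [Z hZ] : subset_q (lat (M *m qlmul a b x)) (lat M).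
  by apply: lat_sub => i; rewrite row_mul mul_qlmul; apply: mul_in => //; exact: lat_row.
have /(mulfI det_neq0) -> : \det M * \det (qlmul a b x) = \det M * \det (map_mx intr Z).
  by rewrite -det_mulmx hZ det_mulmx mulrC.
by rewrite det_intr intr_int.
Qed.

Lemma order_tr_int x : lat M x -> qtr x \is a Num.int.
Proof.
move=> hx.
have -> : qtr x = qnorm a b (x + qone) - qnorm a b x - 1.
  rewrite !qnormE; qsimp; ring.
by rewrite !rpredB ?order_norm_int //; apply: latD.
Qed.

Lemma order_scalar_int c : lat M (c *: qone) -> c \is a Num.int.
Proof.
move=> /order_norm_int h; apply: rat_sqr_int.
by have <- : qnorm a b (c *: qone) = c ^+ 2 by rewrite qnormE; qsimp; ring.
Qed.

Lemma order_dot_int x y : lat M x -> lat M y -> 2%:R * qdot a b x y \is a Num.int.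
Proof.
move=> hx hy.
have -> : 2%:R * qdot a b x y = qnorm a b (x + y) - qnorm a b x - qnorm a b y.
  rewrite !qnormE; qsimp; ring.
by rewrite !rpredB ?order_norm_int //; apply: latD.
Qed.

(** The Smith form of the coordinate row of 1 writes 1 as c times the first vector u of a basis.
    Then u = 1/c is a scalar lying in the order, hence an integer, so 1 can replace u. *)
Lemma order_basis1 : exists x y z, subset_q (lat M) (lat (qmat qone x y z)) /\
  subset_q (lat (qmat qone x y z)) (lat M).
Proof.
case: (one_in) => z0 h0.
have [L _ [R uR [d _ e]]] := int_Smith_normal_form z0.
pose c := L 0 0 * d`_0.
have ez : z0 = c *: row q0 R.
  apply/rowP => j; rewrite e !mxE sum4 !mxE !big_ord1 !mxE /=.
  by rewrite !mulr0n !mulr0 !mul0r !addr0 mulr1n.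
pose N := map_mx intr R *m M.
have NM : subset_q (lat N) (lat M).
  by apply: lat_sub => i; rewrite row_mul; exists (row i R); rewrite map_row.
have MN : subset_q (lat M) (lat N).
  move=> v [w ->]; exists (w *m invmx R).
  by rewrite map_mxM -mulmxA (mulmxA (map_mx _ (invmx R))) -map_mxM mulVmx // map_mx1 mul1mx.
pose u := row q0 N.
have cu : c%:~R *: u = qone.
  by rewrite h0 ez map_mxZ -scalemxAl /u row_mul map_row.
have c0 : c%:~R != 0 :> rat.
  apply/negP => /eqP c0; move: cu; rewrite c0 scale0r => /rowP /(_ q0).
  by rewrite /qone ?qE => /eqP; rewrite eq_sym oner_eq0.
have uE : u = (c%:~R)^-1 *: qone by rewrite -cu scalerA mulVf // scale1r.
have ci : (c%:~R)^-1 \is a @Num.int rat.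
  by apply: order_scalar_int; rewrite -uE; apply/NM/lat_row.
have h1 : qone = c%:~R *: row q0 N by rewrite cu.
exists (row q1 N), (row q2 N), (row q3 N); split => v.
  move/MN; case=> n ->; rewrite mulmx_sum_row sum4 !mxE.
  rewrite -/u uE; case/intrP: ci => m ->.
  apply/lat_qmatP; exists (n 0 q0 * m), (n 0 q1), (n 0 q2), (n 0 q3).
  by rewrite intrM scalerA.
case/lat_qmatP => n0 [n1 [n2 [n3 ->]]].
by apply: NM; rewrite h1; do !apply: latD; do ?apply: latZ; exact: lat_row.
Qed.

Lemma qcom_in x y : lat M x -> lat M y -> lat M (qcom a b x y).
Proof. by move=> hx hy; apply: latB; apply: mul_in. Qed.

Context {x y z : quat} (hM : subset_q (lat M) (lat (qmat qone x y z))).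

(** The norm of [x, y] is twice its pairing with xy, because xy + yx lies in the span of 1, x, y,
    which [x, y] kills. So n is the z-coordinate of xy. *)
Lemma order_com_norm : lat M x -> lat M y ->
  exists n : int, qnorm a b (qcom a b x y) = n%:~R * (4%:R * a%:~R * b%:~R * vol x y z).
Proof.
move=> hx hy; have /lat_qmatP [n0 [n1 [n2 [n3 e]]]] := hM (mul_in hx hy).
exists n3; rewrite -qcom_dot.
have -> : qnorm a b (qcom a b x y) = 2%:R * qdot a b (qcom a b x y) (qmul a b x y).
  rewrite qnorm_dot; qsimp; ring.
rewrite {}e; qsimp; ring.
Qed.

(** Here n is the z-coordinate of [u, v]. This provides the cross coefficients of the integral
    ternary form attached to the order. *)
Lemma order_com_dot u v : lat M u -> lat M v ->
  exists n : int, 2%:R * qdot a b (qcom a b x y) (qcom a b u v)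
    = n%:~R * (4%:R * a%:~R * b%:~R * vol x y z).
Proof.
move=> hu hv; have /lat_qmatP [n0 [n1 [n2 [n3 e]]]] := hM (qcom_in hu hv).
exists n3; rewrite -qcom_dot {}e; qsimp; ring.
Qed.

End Order.

(** * Integral ternary forms modulo a prime *)

Lemma Euclid_dvdzM (l : nat) (x y : int) : prime l ->
  (l%:Z %| x * y)%Z = (l%:Z %| x)%Z || (l%:Z %| y)%Z.
Proof. by move=> pl; rewrite !dvdzE abszM Euclid_dvdM. Qed.

Lemma dvdz_pos_inv (l : nat) (x : int) : prime l -> ~~ (l%:Z %| x)%Z ->
  exists y k : int, y * x = 1 + k * l%:Z.
Proof.
move=> pl nx; have [u [v e]] := Bezoutz x l%:Z.
have g : gcdz x l = 1.
  by rewrite /gcdz (eqP (_ : coprime `|x| l)) // coprime_sym prime_coprime // -dvdzE.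
by exists u, (- v); rewrite -[1]g -e; ring.
Qed.

Definition tform (a b c u v w x y z : int) : int :=
  a * x ^+ 2 + b * y ^+ 2 + c * z ^+ 2 + u * y * z + v * z * x + w * x * y.

(** Half the determinant of the Hessian of [tform]; the halving keeps it meaningful modulo 2. *)
Definition tdisc (a b c u v w : int) : int :=
  4 * a * b * c + u * v * w - a * u ^+ 2 - b * v ^+ 2 - c * w ^+ 2.

(** Norm form of the even Clifford algebra of [tform], in the basis 1, e2 e3, e3 e1, e1 e2. *)
Definition qform (a b c u v w x0 x1 x2 x3 : int) : int :=
  x0 ^+ 2 + b * c * x1 ^+ 2 + a * c * x2 ^+ 2 + a * b * x3 ^+ 2
  + u * x0 * x1 + v * x0 * x2 + w * x0 * x3
  + (u * v - c * w) * x1 * x2 + (u * w - b * v) * x1 * x3 + (v * w - a * u) * x2 * x3.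

Lemma Fp_lift (p : nat) (x : 'F_p) : exists n : int, x = n%:~R.
Proof. by exists (nat_of_ord x)%:Z; rewrite -[RHS]/((nat_of_ord x)%:R) natr_Zp. Qed.

Lemma Fp_eq0 (p : nat) (n : int) : prime p -> (n%:~R == 0 :> 'F_p) = (p%:Z %| n)%Z.
Proof. by move=> pp; rewrite (dvdz_pcharf (pchar_Fp pp)). Qed.

(** For odd l a kernel vector of the Hessian modulo l is also a zero of the form, by Euler's
    identity. At 2 this fails and two cases remain: if u, v, w are even the polar form vanishes, and
    a zero of the diagonal part is enough; otherwise the radical is explicit. *)
Lemma radical_vector (l : nat) (a b c u v w : int) : prime l ->
  (l%:Z %| tdisc a b c u v w)%Z ->
  exists x y z : int, [/\ ~~ [&& (l%:Z %| x)%Z, (l%:Z %| y)%Z & (l%:Z %| z)%Z],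
    (l%:Z %| tform a b c u v w x y z)%Z &
    [/\ (l%:Z %| 2 * a * x + w * y + v * z)%Z, (l%:Z %| w * x + 2 * b * y + u * z)%Z
    & (l%:Z %| v * x + u * y + 2 * c * z)%Z]].
Proof.
move=> pl hN; have [el|ol] := even_prime pl.
  subst l; have [/and3P[eu ev ew]|nz] := boolP [&& (2%:Z %| u)%Z, (2%:Z %| v)%Z & (2%:Z %| w)%Z].
    have [x [y [z [h1 h2]]]] : exists x y z : int, ~~ [&& (2%:Z %| x)%Z, (2%:Z %| y)%Z & (2%:Z %| z)%Z]
       /\ (2%:Z %| a * x ^+ 2 + b * y ^+ 2 + c * z ^+ 2)%Z.
      have [ha|ha] := boolP (2%:Z %| a)%Z.
        by exists 1, 0, 0; split=> //; rewrite !expr2; lia.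
      have [hb|hb] := boolP (2%:Z %| b)%Z.
        by exists 0, 1, 0; split=> //; rewrite !expr2; lia.
      by exists 1, 1, 0; split=> //; rewrite !expr2; lia.
    exists x, y, z; split=> //; rewrite /tform.
      by rewrite -!addrA addrA addrA rpredD // !rpredD // !dvdz_mulr.
    by split; rewrite -?mulrA !rpredD // dvdz_mulr.
  (* Modulo 2 the polar form is alternating with entries u, v, w, so (u, v, w) lies in its radical;
     the form takes there the value of the discriminant modulo 2. *)
  exists u, v, w; split=> //.
    have -> : tform a b c u v w u v w = tdisc a b c u v w
       + 2 * (u * v * w + a * u ^+ 2 + b * v ^+ 2 + c * w ^+ 2 - 2 * a * b * c).
      rewrite /tform /tdisc; ring.
    by rewrite rpredD // dvdz_mulr.
  split.
  - have -> : 2 * a * u + w * v + v * w = 2 * (a * u + v * w) by ring.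
    exact: dvdz_mulr.
  - have -> : w * u + 2 * b * v + u * w = 2 * (b * v + u * w) by ring.
    exact: dvdz_mulr.
  - have -> : v * u + u * v + 2 * c * w = 2 * (c * w + u * v) by ring.
    exact: dvdz_mulr.
pose rows : seq (seq int) := [:: [:: 2 * a; w; v]; [:: w; 2 * b; u]; [:: v; u; 2 * c]].
pose A : 'M[int]_3 := \matrix_(i, j) (nth 0 (nth [::] rows i) j).
have dA : \det A = 2 * tdisc a b c u v w.
  rewrite (expand_det_row _ ord0) !big_ord_recl big_ord0.
  rewrite /cofactor !(expand_det_row _ ord0) !big_ord_recl !big_ord0.
  rewrite /cofactor !det_mx11 !mxE /= /tdisc /bump /= !exprS !expr0; ring.
have : \det (map_mx intr A : 'M['F_l]_3) == 0.
  rewrite det_map_mx Fp_eq0 // dA.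
  by rewrite dvdz_mull.
case/det0P => V nV VA.
pose i0 : 'I_3 := 0; pose i1 : 'I_3 := 1; pose i2 : 'I_3 := 1 + 1.
have [x hx] := Fp_lift (V 0 i0); have [y hy] := Fp_lift (V 0 i1).
have [z hz] := Fp_lift (V 0 i2).
have key j : (l%:Z %| x * A i0 j + y * A i1 j + z * A i2 j)%Z.
  rewrite -Fp_eq0 // !rmorphD !rmorphM /= -hx -hy -hz.
  have /rowP /(_ j) := VA; rewrite !mxE !big_ord_recl big_ord0 !mxE addr0 addrA => e.
  apply/eqP; rewrite -[RHS]e; congr (_ * _%:~R + _ * _%:~R + _ * _%:~R); rewrite ?mxE //;
    congr (V _ _); exact: val_inj.
have k0 : (l%:Z %| 2 * a * x + w * y + v * z)%Z.
  by have := key i0; rewrite !mxE /= ![_ * x]mulrC ![_ * y]mulrC ![_ * z]mulrC.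
have k1 : (l%:Z %| w * x + 2 * b * y + u * z)%Z.
  by have := key i1; rewrite !mxE /= ![_ * x]mulrC ![_ * y]mulrC ![_ * z]mulrC.
have k2 : (l%:Z %| v * x + u * y + 2 * c * z)%Z.
  by have := key i2; rewrite !mxE /= ![_ * x]mulrC ![_ * y]mulrC ![_ * z]mulrC.
exists x, y, z; split=> //.
  apply: contra nV => /and3P[]; rewrite -!Fp_eq0 // -hx -hy -hz => /eqP h0 /eqP h1 /eqP h2.
  apply/eqP/rowP => i; rewrite mxE; case: i => [[|[|[|//]]] hi].
  - by rewrite -[RHS]h0; congr (V _ _); exact: val_inj.
  - by rewrite -[RHS]h1; congr (V _ _); exact: val_inj.
  - by rewrite -[RHS]h2; congr (V _ _); exact: val_inj.
have : (l%:Z %| 2 * tform a b c u v w x y z)%Z.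
  have -> : 2 * tform a b c u v w x y z = x * (2 * a * x + w * y + v * z)
    + y * (w * x + 2 * b * y + u * z) + z * (v * x + u * y + 2 * c * z).
    rewrite /tform; ring.
  by rewrite !rpredD // dvdz_mull.
rewrite Euclid_dvdzM // => /orP[|//].
rewrite dvdzE /= => h2; move: ol; have := dvdn_leq (ltn0Sn 1) h2.
by case: (l) pl => [|[|[|]]].
Qed.

Lemma dvd2_mul_add (a b : int) : (2%:Z %| a * b * (a + b))%Z.
Proof.
have := boolP (2%:Z %| a)%Z; have := boolP (2%:Z %| b)%Z.
move=> [h|h] [h'|h']; rewrite !Euclid_dvdzM // ?h ?h' ?orbT //=.
by move: h h'; lia.
Qed.

(** * A plane anisotropic modulo l plus l times a unit *)

Section Aniso.
Variables (l : nat) (a b c u v w : int).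
Hypothesis pl : prime l.
Hypothesis an : forall x y : int, (l%:Z %| a * x ^+ 2 + b * y ^+ 2 + w * x * y)%Z ->
  (l%:Z %| x)%Z /\ (l%:Z %| y)%Z.

Let l1 : ~ (l%:Z %| 1)%Z.
Proof. by rewrite dvdzE /= dvdn1 => /eqP h; move: pl; rewrite h. Qed.

Let na : ~ (l%:Z %| a)%Z.
Proof.
move=> h; have [] := @an 1 0.
  by rewrite expr1n expr0n /= !mulr0 mulr1 !addr0.
by move/l1.
Qed.

(** Modulo l the norm form only involves x0 and x3, and a times it is the plane form at (x0, a x3),
    so l divides both. What remains, divided by l, is c1 times the plane form at (x2, -x1) modulo l.
    This second round uses the square of l. *)
Lemma aniso_qform (c1 u1 v1 : int) :
  c = l%:Z * c1 -> u = l%:Z * u1 -> v = l%:Z * v1 -> ~ (l%:Z %| c1)%Z ->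
  forall x0 x1 x2 x3 : int, (l%:Z ^+ 2 %| qform a b c u v w x0 x1 x2 x3)%Z ->
  [&& (l%:Z %| x0)%Z, (l%:Z %| x1)%Z, (l%:Z %| x2)%Z & (l%:Z %| x3)%Z].
Proof.
move=> hc hu hv nc1 x0 x1 x2 x3 /dvdzP[k hk].
have h03 : (l%:Z %| a * x0 ^+ 2 + b * (a * x3) ^+ 2 + w * x0 * (a * x3))%Z.
  apply/dvdzP; exists (a * (k * l%:Z - (b * c1 * x1 ^+ 2 + a * c1 * x2 ^+ 2
     + u1 * x0 * x1 + v1 * x0 * x2
     + (u1 * v - c1 * w) * x1 * x2 + (u1 * w - b * v1) * x1 * x3 + (v1 * w - a * u1) * x2 * x3))).
  have -> : a * x0 ^+ 2 + b * (a * x3) ^+ 2 + w * x0 * (a * x3) =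
    a * (qform a b c u v w x0 x1 x2 x3 - (qform a b c u v w x0 x1 x2 x3 -
     (x0 ^+ 2 + a * b * x3 ^+ 2 + w * x0 * x3))) by ring.
  rewrite {1}hk /qform hc hu hv; ring.
have [/dvdzP[y0 e0]] := an h03; rewrite Euclid_dvdzM // => /orP[/na //|/dvdzP[y3 e3]].
have h12 : (l%:Z %| c1 * (a * x2 ^+ 2 + b * (- x1) ^+ 2 + w * x2 * (- x1)))%Z.
  have l0 : l%:Z != 0 by case: (l) pl.
  apply/dvdzP; exists (k - (y0 ^+ 2 + a * b * y3 ^+ 2 + u1 * y0 * x1 + v1 * y0 * x2
     + w * y0 * y3 + u1 * v1 * x1 * x2 + (u1 * w - b * v1) * x1 * y3
     + (v1 * w - a * u1) * x2 * y3)).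
  apply: (mulfI l0); apply/eqP; rewrite -subr_eq0; apply/eqP.
  have := hk; rewrite /qform hc hu hv e0 e3 => /eqP; rewrite -subr_eq0 => /eqP hk'.
  rewrite -[RHS]hk'; ring.
move: h12; rewrite Euclid_dvdzM // => /orP[/nc1 //|/an [h2]].
rewrite dvdzE abszN -dvdzE => h1.
by rewrite h1 h2 e0 e3 !dvdz_mull.
Qed.

(** Divisibility by the square of l would force l to divide 4ab - w^2. Then (-w, 2a) is a zero of
    the plane form, so l divides w and 2a, which leaves l = 2. There (b, a) is a zero, since ab(a +
    b) is always even, and a would be even. *)
Lemma aniso_tdisc (c1 u1 v1 : int) :
  c = l%:Z * c1 -> u = l%:Z * u1 -> v = l%:Z * v1 -> ~ (l%:Z %| c1)%Z ->
  ~ (l%:Z ^+ 2 %| tdisc a b c u v w)%Z.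
Proof.
move=> hc hu hv nc1 /dvdzP[k hk].
have : (l%:Z %| c1 * (4 * a * b - w ^+ 2))%Z.
  have l0 : l%:Z != 0 by case: (l) pl.
  apply/dvdzP; exists (k - (u1 * v1 * w - a * u1 ^+ 2 - b * v1 ^+ 2)).
  apply: (mulfI l0); apply/eqP; rewrite -subr_eq0; apply/eqP.
  have := hk; rewrite /tdisc hc hu hv => /eqP; rewrite -subr_eq0 => /eqP hk'.
  rewrite -[RHS]hk'; ring.
rewrite Euclid_dvdzM // => /orP[/nc1 //|hd].
have [] := @an (- w) (2 * a).
  have -> : a * (- w) ^+ 2 + b * (2 * a) ^+ 2 + w * - w * (2 * a) = a * (4 * a * b - w ^+ 2) by ring.
  by rewrite dvdz_mull.
rewrite dvdzE abszN -dvdzE => lw; rewrite Euclid_dvdzM // => /orP[|/na //].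
rewrite dvdzE /= => h2; have := dvdn_leq (ltn0Sn 1) h2 => l2.
have el : l = 2%N by case: (l) pl l2 => [|[|[|]]].
have [] := @an b a; last by move=> _ /na.
have -> : a * b ^+ 2 + b * a ^+ 2 + w * b * a = a * b * (a + b) + w * (a * b) by ring.
apply: rpredD; last by rewrite dvdz_mulr.
by rewrite el dvd2_mul_add.
Qed.

End Aniso.

(** The integers from 0 to (p - 1)/2 have distinct squares modulo p, so X^2 and -de - al Y^2 each
    take (p + 1)/2 values; two such sets must meet in a field of p elements. *)
Lemma sqr_pigeonhole (p : nat) (al de : int) : prime p -> odd p -> ~ (p%:Z %| al)%Z ->
  exists X Y : int, (p%:Z %| X ^+ 2 + al * Y ^+ 2 + de)%Z.
Proof.
move=> pp op nal; pose m := p./2.+1.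
have pm : p = (p./2 * 2).+1 by rewrite -[LHS]odd_double_half op muln2.
have sq (i j : 'I_m) : (p%:Z %| (i%:Z) ^+ 2 - (j%:Z) ^+ 2)%Z -> i = j.
  rewrite subr_sqr Euclid_dvdzM // => h; apply: val_inj => /=.
  have li : (i <= p./2)%N by rewrite -ltnS.
  have lj : (j <= p./2)%N by rewrite -ltnS.
  case/orP: h => /dvdzP[k hk].
    by case: k hk => [[|k]|k] hk; nia.
  by case: k hk => [[|k]|k] hk; nia.
pose f (i : 'I_m) : 'F_p := ((i%:Z) ^+ 2)%:~R.
pose g (i : 'I_m) : 'F_p := (- de - al * (i%:Z) ^+ 2)%:~R.
have fi : injective f.
  by move=> i j /eqP; rewrite -subr_eq0 -rmorphB /= Fp_eq0 //; apply: sq.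
have gi : injective g.
  move=> i j /eqP; rewrite -subr_eq0 -rmorphB /= Fp_eq0 // => h; apply/esym/sq.
  have : (p%:Z %| al * ((j%:Z) ^+ 2 - (i%:Z) ^+ 2))%Z.
    by have -> : al * (j%:Z ^+ 2 - i%:Z ^+ 2) =
      - de - al * i%:Z ^+ 2 - (- de - al * j%:Z ^+ 2) by ring.
  by rewrite Euclid_dvdzM // => /orP[].
have : ~~ [disjoint f @: setT & g @: setT].
  apply/negP => dj; have := leq_card_setU (f @: setT) (g @: setT).
  move: dj; rewrite -(leq_card_setU (f @: setT) (g @: setT)) => /eqP e _.
  have := subset_leq_card (subsetT (f @: setT :|: g @: setT)).
  rewrite e !card_imset // !cardsT card_Fp // !card_ord /m; lia.
case/pred0Pn => z /andP[/imsetP[i _ hi] /imsetP[j _ hj]].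
exists i%:Z, j%:Z; rewrite -Fp_eq0 //.
have -> : i%:Z ^+ 2 + al * j%:Z ^+ 2 + de = i%:Z ^+ 2 - (- de - al * j%:Z ^+ 2) by ring.
by rewrite rmorphB /= subr_eq0 -/(f i) -/(g j) -hi -hj.
Qed.

(** * Primitive zeros of the norm form modulo powers of p *)

Section Isotropic.
Variables (p : nat) (a b c u v w : int).
Hypothesis (pp : prime p) (op : odd p).
Local Notation Q := (qform a b c u v w).
Local Notation divp x := (p%:Z %| x)%Z.

Let p2 : ~ divp 2.
Proof.
rewrite dvdzE /= => h2; have := dvdn_leq (ltn0Sn 1) h2.
by case: (p) pp op => [|[|[|]]].
Qed.

Lemma qform_isotropic_mod : exists x0 x1 x2 x3 : int,
  ~~ [&& divp x0, divp x1, divp x2 & divp x3] /\ divp (Q x0 x1 x2 x3).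
Proof.
(* For x3 = 0, completing the square gives 4Q = (2 x0 + u x1 + v x2)^2 + al x1^2 + 2 be x1 x2 + ga
   x2^2. *)
pose al := 4 * b * c - u ^+ 2; pose be := u * v - 2 * c * w; pose ga := 4 * a * c - v ^+ 2.
have [h|/negP h] := boolP (divp al).
  exists (- u), 2, 0, 0; split; first by rewrite !negb_and; move/negP: p2 => ->; rewrite orbT.
  have -> : Q (- u) 2 0 0 = al by rewrite /qform /al; ring.
  exact: h.
have [X [Y hXY]] := @sqr_pigeonhole p al (al * ga - be ^+ 2) pp op h.
(* With x2 = 2 al, the other coordinates solve al x1 + be x2 = 2 al X and 2 x0 + u x1 + v x2 = 2 al
   Y, which turns 4 al Q into (2 al)^2 times the value found by the pigeonhole. *)
exists (al * Y - u * (X - be) - v * al), (2 * (X - be)), (2 * al), 0; split.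
  rewrite !negb_and; have -> : ~~ divp (2 * al).
    by rewrite Euclid_dvdzM //; apply/negP => /orP[/p2|/h].
  by rewrite !orbT.
set q := Q _ _ _ _.
have : divp (4 * al * q).
  have -> : 4 * al * q = (2 * al) ^+ 2 * (X ^+ 2 + al * Y ^+ 2 + (al * ga - be ^+ 2)).
    rewrite /q /qform /al /be /ga; ring.
  exact: dvdz_mull.
have -> : 4 * al * q = 2 * (2 * (al * q)) by ring.
rewrite Euclid_dvdzM // => /orP[/p2 //|].
rewrite Euclid_dvdzM // => /orP[/p2 //|].
by rewrite Euclid_dvdzM // => /orP[/h //|].
Qed.

Hypothesis nN : ~ divp (tdisc a b c u v w).

(* Eliminating x0 from the gradient leaves the adjugate of the Gram matrix of the ternary form
   applied to (x1, x2, x3), whose inverse is that Gram matrix up to the factor 2 * tdisc. *)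
Lemma qform_gradient x0 x1 x2 x3 :
  divp (2 * x0 + u * x1 + v * x2 + w * x3) ->
  divp (u * x0 + 2 * b * c * x1 + (u * v - c * w) * x2 + (u * w - b * v) * x3) ->
  divp (v * x0 + (u * v - c * w) * x1 + 2 * a * c * x2 + (v * w - a * u) * x3) ->
  divp (w * x0 + (u * w - b * v) * x1 + (v * w - a * u) * x2 + 2 * a * b * x3) ->
  [&& divp x0, divp x1, divp x2 & divp x3].
Proof.
move=> /dvdzP[k0 h0] /dvdzP[k1 h1] /dvdzP[k2 h2] /dvdzP[k3 h3].
pose g1 := 2 * k1 - u * k0; pose g2 := 2 * k2 - v * k0; pose g3 := 2 * k3 - w * k0.
have key x m : 2 * (tdisc a b c u v w * x) = m * p%:Z -> divp x.
  move=> e; have : divp (2 * (tdisc a b c u v w * x)) by apply/dvdzP; exists m.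
  rewrite Euclid_dvdzM // => /orP[/p2 //|].
  by rewrite Euclid_dvdzM // => /orP[/nN //|].
have d1 : divp x1.
  apply: (key _ (2 * a * g1 + w * g2 + v * g3)).
  transitivity (2 * a * (2 * (k1 * p%:Z) - u * (k0 * p%:Z)) + w * (2 * (k2 * p%:Z) - v * (k0 * p%:Z))
     + v * (2 * (k3 * p%:Z) - w * (k0 * p%:Z))); last by rewrite /g1 /g2 /g3; ring.
  rewrite -h0 -h1 -h2 -h3 /tdisc; ring.
have d2 : divp x2.
  apply: (key _ (w * g1 + 2 * b * g2 + u * g3)).
  transitivity (w * (2 * (k1 * p%:Z) - u * (k0 * p%:Z)) + 2 * b * (2 * (k2 * p%:Z) - v * (k0 * p%:Z))
     + u * (2 * (k3 * p%:Z) - w * (k0 * p%:Z))); last by rewrite /g1 /g2 /g3; ring.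
  rewrite -h0 -h1 -h2 -h3 /tdisc; ring.
have d3 : divp x3.
  apply: (key _ (v * g1 + u * g2 + 2 * c * g3)).
  transitivity (v * (2 * (k1 * p%:Z) - u * (k0 * p%:Z)) + u * (2 * (k2 * p%:Z) - v * (k0 * p%:Z))
     + 2 * c * (2 * (k3 * p%:Z) - w * (k0 * p%:Z))); last by rewrite /g1 /g2 /g3; ring.
  rewrite -h0 -h1 -h2 -h3 /tdisc; ring.
rewrite d1 d2 d3 !andbT.
have : divp (2 * x0).
  have -> : 2 * x0 = k0 * p%:Z - u * x1 - v * x2 - w * x3 by rewrite -h0; ring.
  by rewrite !rpredB // dvdz_mull.
by rewrite Euclid_dvdzM // => /orP[/p2 //|].
Qed.

(** One Hensel step. At a primitive vector the gradient is nonzero modulo p, so some direction z has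
    unit derivative. Moving by q t z with q = p^(k+1) cancels the error m q modulo p^(k+2), and the
    quadratic term carries q^2. *)
Lemma qform_lift (k : nat) x0 x1 x2 x3 : ~~ [&& divp x0, divp x1, divp x2 & divp x3] ->
  (p%:Z ^+ k.+1 %| Q x0 x1 x2 x3)%Z ->
  exists y0 y1 y2 y3 : int, ~~ [&& divp y0, divp y1, divp y2 & divp y3] /\ (p%:Z ^+ k.+2 %| Q y0 y1 y2 y3)%Z.
Proof.
move=> nx /dvdzP[m hm].
pose g0 := 2 * x0 + u * x1 + v * x2 + w * x3.
pose g1 := u * x0 + 2 * b * c * x1 + (u * v - c * w) * x2 + (u * w - b * v) * x3.
pose g2 := v * x0 + (u * v - c * w) * x1 + 2 * a * c * x2 + (v * w - a * u) * x3.
pose g3 := w * x0 + (u * w - b * v) * x1 + (v * w - a * u) * x2 + 2 * a * b * x3.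
have [z0 [z1 [z2 [z3 nz]]]] : exists z0 z1 z2 z3 : int,
    ~~ divp (g0 * z0 + g1 * z1 + g2 * z2 + g3 * z3).
  have [d0|n0] := boolP (divp g0); last by exists 1, 0, 0, 0; rewrite !mulr0 mulr1 !addr0.
  have [d1|n1] := boolP (divp g1); last by exists 0, 1, 0, 0; rewrite !mulr0 mulr1 !addr0 add0r.
  have [d2|n2] := boolP (divp g2); last by exists 0, 0, 1, 0; rewrite !mulr0 mulr1 !addr0 !add0r.
  have [d3|n3] := boolP (divp g3); last by exists 0, 0, 0, 1; rewrite !mulr0 mulr1 !add0r.
  by move: nx; rewrite qform_gradient.
have [y [j hy]] := dvdz_pos_inv pp nz.
pose t := - m * y; pose q := p%:Z ^+ k.+1.
exists (x0 + q * t * z0), (x1 + q * t * z1), (x2 + q * t * z2), (x3 + q * t * z3).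
have dq z : divp (q * t * z) by rewrite /q exprS -!mulrA dvdz_mulr.
have dD x z : divp (x + q * t * z) = divp x by exact: rpredDr.
split; first by rewrite !dD.
apply/dvdzP; exists (- m * j + p%:Z ^+ k * t ^+ 2 * Q z0 z1 z2 z3).
have -> : Q (x0 + q * t * z0) (x1 + q * t * z1) (x2 + q * t * z2) (x3 + q * t * z3)
   = Q x0 x1 x2 x3 - q * m * (y * (g0 * z0 + g1 * z1 + g2 * z2 + g3 * z3))
     + q ^+ 2 * t ^+ 2 * Q z0 z1 z2 z3.
  rewrite /qform /t /g0 /g1 /g2 /g3; ring.
rewrite hm hy /q !exprS; ring.
Qed.

Lemma qform_isotropic (k : nat) : exists x0 x1 x2 x3 : int,
  ~~ [&& divp x0, divp x1, divp x2 & divp x3] /\ (p%:Z ^+ k.+1 %| Q x0 x1 x2 x3)%Z.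
Proof.
elim: k => [|k [x0 [x1 [x2 [x3 [nx hx]]]]]]; last exact: qform_lift hx.
by rewrite expr1; exact: qform_isotropic_mod.
Qed.

End Isotropic.

(** * Even Clifford orders *)

(* With f = s * nrd on the span of l1, l2, l3, these are the products spanning the even Clifford algebra of f. *)
Definition qcl (a b : int) (s : rat) (x y : quat) : quat := s *: qmul a b x (qconj y).
Definition qn (a b : int) (s : rat) (x : quat) : rat := s * qnorm a b x.
Definition qt (a b : int) (s : rat) (x y : quat) : rat := s * (2%:R * qdot a b x y).

Section Clifford.
Context {a b : int} {s : rat}.
Local Notation e := (qcl a b s).
Local Notation n := (qn a b s).
Local Notation t := (qt a b s).

Lemma qt_sym x y : t x y = t y x.
Proof. rewrite /qt /qdot; ring. Qed.

(** With the next two lemmas on chains and diagonal terms, these are the relations of the even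
    Clifford algebra; each comes from polarizing the norm or from the product of y with its
    conjugate being scalar. *)
Lemma qcl_swap x y : e y x = t x y *: qone - e x y.
Proof. rewrite /qcl /qt; qring. Qed.

Lemma qcl_chain x y z : qmul a b (e x y) (e y z) = n y *: e x z.
Proof.
rewrite /qcl /qn qmulZl qmulZr !scalerA.
have -> : qmul a b (qmul a b x (qconj y)) (qmul a b y (qconj z)) =
  qnorm a b y *: qmul a b x (qconj z) by rewrite qnormE; qring.
rewrite scalerA; congr (_ *: _); ring.
Qed.

Lemma qcl_diag x : e x x = n x *: qone.
Proof. rewrite /qcl /qn qnormE; qring. Qed.

Lemma qcl_mul_swap x y z : qmul a b (e x y) (e z x) =
  (t y x * t x z) *: qone - t y x *: e x z - t x z *: e y x + n x *: e y z.
Proof.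
have h c d u v : qmul a b (c *: qone - u) (d *: qone - v) =
  (c * d) *: qone - c *: v - d *: u + qmul a b u v by qring.
by rewrite -qcl_chain (qcl_swap y x) (qcl_swap x z) h.
Qed.

Lemma qcl_sqr x y : qmul a b (e x y) (e x y) = t x y *: e x y - (n x * n y) *: qone.
Proof.
have h c u v : qmul a b (c *: qone - u) v = c *: v - qmul a b u v by qring.
have := qcl_chain y x y; rewrite (qcl_swap x y) qcl_diag h [n x *: (n y *: _)]scalerA => <-.
by rewrite subKr.
Qed.

Lemma qnorm_qcl x y : qnorm a b (e x y) = n x * n y.
Proof.
have h c w : qnorm a b (c *: w) = c ^+ 2 * qnorm a b w by rewrite !qnormE ?qE; ring.
have h' w : qnorm a b (qconj w) = qnorm a b w by rewrite !qnormE; qsimp; ring.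
rewrite /qcl h qnormM h' /qn; ring.
Qed.

Lemma qdot_qone_qcl x y : 2%:R * qdot a b qone (e x y) = t x y.
Proof. rewrite /qcl /qt; qsimp; ring. Qed.

Lemma qdot_qcl x y z : 2%:R * qdot a b (e x y) (e y z) = t x y * t y z - n y * t z x.
Proof. rewrite /qcl /qt /qn qnormE; qsimp; ring. Qed.

End Clifford.

Definition ord3 a b s l1 l2 l3 : 'M[rat]_4 :=
  qmat qone (qcl a b s l2 l3) (qcl a b s l3 l1) (qcl a b s l1 l2).

Definition int3 a b s l1 l2 l3 : Prop :=
  [/\ qn a b s l1 \is a Num.int, qn a b s l2 \is a Num.int & qn a b s l3 \is a Num.int] /\
  [/\ qt a b s l2 l3 \is a Num.int, qt a b s l3 l1 \is a Num.int & qt a b s l1 l2 \is a Num.int].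

Definition disc3 a b s l1 l2 l3 : rat :=
  4%:R * qn a b s l1 * qn a b s l2 * qn a b s l3
  + qt a b s l2 l3 * qt a b s l3 l1 * qt a b s l1 l2
  - qn a b s l1 * qt a b s l2 l3 ^+ 2 - qn a b s l2 * qt a b s l3 l1 ^+ 2
  - qn a b s l3 * qt a b s l1 l2 ^+ 2.

Definition form4 (a b c u v w x0 x1 x2 x3 : rat) : rat :=
  x0 ^+ 2 + b * c * x1 ^+ 2 + a * c * x2 ^+ 2 + a * b * x3 ^+ 2
  + u * x0 * x1 + v * x0 * x2 + w * x0 * x3
  + (u * v - c * w) * x1 * x2 + (u * w - b * v) * x1 * x3 + (v * w - a * u) * x2 * x3.

Lemma lat_mul_closed a b M : (forall i j, lat M (qmul a b (row i M) (row j M))) ->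
  forall x y, lat M x -> lat M y -> lat M (qmul a b x y).
Proof.
move=> h x y [z ->] [w ->].
rewrite [z in qmul a b z]mulmx_sum_row [w in qmul a b _ w]mulmx_sum_row.
elim/big_ind: _ => [|u v hu hv|i _].
- by have -> : qmul a b 0 (\sum_i map_mx intr w 0 i *: row i M) = 0; [qring|exact: lat0].
- by rewrite qmulDl; apply: latD.
rewrite qmulZl mxE; apply: latZ.
elim/big_ind: _ => [|u v hu hv|j _].
- by have -> : qmul a b (row i M) 0 = 0; [qring|exact: lat0].
- by rewrite qmulDr; apply: latD.
by rewrite qmulZr mxE; apply: latZ.
Qed.

Section Ord3.
Context {a b : int} {s : rat} {l1 l2 l3 : quat}.
Local Notation e := (qcl a b s).
Local Notation n := (qn a b s).
Local Notation t := (qt a b s).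
Local Notation O := (ord3 a b s l1 l2 l3).

Lemma qnorm_ord3 x0 x1 x2 x3 :
  qnorm a b (x0 *: qone + x1 *: e l2 l3 + x2 *: e l3 l1 + x3 *: e l1 l2) =
  form4 (n l1) (n l2) (n l3) (t l2 l3) (t l3 l1) (t l1 l2) x0 x1 x2 x3.
Proof.
have h p q r w : qnorm a b (x0 *: p + x1 *: q + x2 *: r + x3 *: w) =
  x0 ^+ 2 * qnorm a b p + x1 ^+ 2 * qnorm a b q + x2 ^+ 2 * qnorm a b r
  + x3 ^+ 2 * qnorm a b w + x0 * x1 * (2%:R * qdot a b p q) + x0 * x2 * (2%:R * qdot a b p r)
  + x0 * x3 * (2%:R * qdot a b p w) + x1 * x2 * (2%:R * qdot a b q r)
  + x1 * x3 * (2%:R * qdot a b w q) + x2 * x3 * (2%:R * qdot a b r w).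
  rewrite !qnormE; qsimp; ring.
have e0 : qnorm a b qone = 1 by rewrite qnormE; qsimp; ring.
rewrite h !qnorm_qcl !qdot_qone_qcl !qdot_qcl e0 /form4; ring.
Qed.

(** The reduced discriminant of the even Clifford order is, up to sign, the half-discriminant of its
    ternary form. This turns a comparison of orders into a comparison of forms. *)
Lemma disc3_vol : 4%:R * a%:~R * b%:~R * vol (e l2 l3) (e l3 l1) (e l1 l2) =
  - disc3 a b s l1 l2 l3.
Proof.
rewrite -qcom_dot.
have -> : qcom a b (e l2 l3) (e l3 l1) = (n l3 * t l1 l2 + t l2 l3 * t l3 l1) *: qone
    - t l3 l1 *: e l2 l3 - t l2 l3 *: e l3 l1 - (2%:R * n l3) *: e l1 l2.
  rewrite /qcom qcl_chain qcl_mul_swap (qcl_swap l1 l2) (qcl_swap l2 l3) (qcl_swap l3 l1).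
  rewrite (qt_sym l1 l3) (qt_sym l3 l2).
    by move: (e l2 l3) (e l3 l1) (e l1 l2) => x y z; apply: quatP; rewrite ?qE; ring.
have d4 w x y z c1 c2 c3 c4 : 2%:R * qdot a b (c1 *: w - c2 *: x - c3 *: y - c4 *: z) z =
   c1 * (2%:R * qdot a b w z) - c2 * (2%:R * qdot a b z x) - c3 * (2%:R * qdot a b y z)
   - c4 * (2%:R * qnorm a b z) by rewrite qnormE; qsimp; ring.
rewrite d4 qdot_qone_qcl !qdot_qcl qnorm_qcl /disc3; ring.
Qed.

Hypothesis hI : int3 a b s l1 l2 l3.

Lemma ord3_basis : [/\ lat O qone, lat O (e l2 l3), lat O (e l3 l1) & lat O (e l1 l2)].
Proof.
by split; [have := lat_row O q0|have := lat_row O q1|have := lat_row O q2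
  |have := lat_row O q3]; rewrite row_qmat.
Qed.

Lemma ord3_basis_swap : [/\ lat O (e l3 l2), lat O (e l1 l3) & lat O (e l2 l1)].
Proof.
case: hI => _ [h1 h2 h3]; case: ord3_basis => b0 b1 b2 b3.
by split; rewrite qcl_swap; apply: latB => //; apply: latZint.
Qed.

(** Products of two nontrivial basis elements are of three kinds: squares, chains sharing the inner
    vector, and products sharing the outer vector. Each expands with coefficients that are
    polynomials in the integers n and t. *)
Lemma ord3_order : vol (e l2 l3) (e l3 l1) (e l1 l2) != 0 -> is_order a b O.
Proof.
move=> nz; split; first by rewrite unitmxE unitfE det_qmat1.
case: (hI) => [[i1 i2 i3] [j1 j2 j3]]; case: ord3_basis => b0 b1 b2 b3.
case: ord3_basis_swap => c1 c2 c3.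
split=> //; apply: lat_mul_closed.
have h w : qmul a b qone w = w by qring.
have h' w : qmul a b w qone = w by qring.
have k x y : n x \is a Num.int -> n y \is a Num.int -> t x y \is a Num.int ->
    lat O (e x y) -> lat O (qmul a b (e x y) (e x y)).
  by move=> *; rewrite qcl_sqr; apply: latB; apply: latZint => //; apply: rpredM.
have k1 x y z : n y \is a Num.int -> lat O (e x z) ->
    lat O (qmul a b (e x y) (e y z)).
  by move=> *; rewrite qcl_chain; apply: latZint.
have k2 x y z : n x \is a Num.int -> t x y \is a Num.int -> t z x \is a Num.int ->
    lat O (e x z) -> lat O (e y x) -> lat O (e y z) ->
    lat O (qmul a b (e x y) (e z x)).
  move=> h1 h2 h3 *; rewrite qcl_mul_swap (qt_sym y x) (qt_sym x z).
  by apply: latD; [apply: latB; [apply: latB|]|]; apply: latZint => //; apply: rpredM.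
apply: row4P => [j|||]; first by rewrite row_qmat h; exact: lat_row.
- apply: row4P; rewrite !row_qmat ?h' //.
  + exact: (k _ _ i2 i3 j1 b1).
  + exact: (k1 _ _ _ i3 c3).
  + exact: (k2 _ _ _ i2 j1 j3 c3 c1 b2).
- apply: row4P; rewrite !row_qmat ?h' //.
  + exact: (k2 _ _ _ i3 j2 j1 c1 c2 b3).
  + exact: (k _ _ i3 i1 j2 b2).
  + exact: (k1 _ _ _ i1 c1).
- apply: row4P; rewrite !row_qmat ?h' //.
  + exact: (k1 _ _ _ i2 c2).
  + exact: (k2 _ _ _ i1 j3 j2 c2 c3 b1).
  + exact: (k _ _ i1 i2 j3 b3).
Qed.

End Ord3.

(** * Overorders *)

Lemma qcomE a b x y : qcom a b x y = mkq 0
  (- 2%:R * b%:~R * (x 0 q2 * y 0 q3 - x 0 q3 * y 0 q2))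
  (2%:R * a%:~R * (x 0 q1 * y 0 q3 - x 0 q3 * y 0 q1))
  (2%:R * (x 0 q1 * y 0 q2 - x 0 q2 * y 0 q1)).
Proof. qring. Qed.

Section MaxOrder.
Context {a b : int} (a0 : a != 0) (b0 : b != 0).

(** A double cross product formula: the cross product of z x and x y is a multiple of x by the
    triple product. Commutators thus give back the order, up to scalars and division by the
    discriminant. *)
Lemma qcom_recover x y z : exists c : rat,
  qmul a b (qcom a b z x) (qconj (qcom a b x y)) =
  c *: qone - (4%:R * a%:~R * b%:~R * vol x y z) *: x.
Proof.
(* This value of c is read off from the scalar coordinate, so only the pure coordinates carry
   content. *)
exists ((qmul a b (qcom a b z x) (qconj (qcom a b x y))) 0 q0
        + (4%:R * a%:~R * b%:~R * vol x y z) * x 0 q0).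
rewrite !qcomE; qring.
Qed.

(** With m = 2c the last condition gives m^2 = 2mt + 4j, so m is even. It is applied to a scalar
    known only through traces and norms of order elements. *)
Lemma half_int_quadratic (c t : rat) : 2%:R * c \is a Num.int -> t \is a Num.int ->
  c ^+ 2 - c * t \is a Num.int -> c \is a Num.int.
Proof.
move=> /intrP[m hm] /intrP[k ->] /intrP[j hj].
have e : m ^+ 2 - 2 * (m * k) = 4 * j.
  apply/eqP; rewrite -(eqr_int rat) rmorphB /= !intrM -hm -hj; apply/eqP; ring.
have [q hq] : exists q : int, m = 2 * q.
  have [q [hq|hq]] : exists q : int, m = 2 * q \/ m = 2 * q + 1.
    by exists (m %/ 2)%Z; lia.
  - by exists q.
  - by exfalso; move: e; rewrite hq expr2; lia.
have -> : c = q%:~R by move: hm; rewrite hq intrM; lra.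
exact: intr_int.
Qed.

Definition covered M s l1 l2 l3 : Prop :=
  int3 a b s l1 l2 l3 /\ subset_q (lat M) (lat (ord3 a b s l1 l2 l3)).

(** The ternary lattice is spanned by the commutators of a basis 1, x, y, z, with the norm divided
    by the discriminant N. Integrality is the divisibility of commutator norms and pairings by N. *)
Lemma order_covered M : is_order a b M -> exists s l1 l2 l3, covered M s l1 l2 l3.
Proof.
move=> oM; have [x [y [z [MX XM]]]] := order_basis1 oM.
have nz : vol x y z != 0.
  have uM : M \in unitmx by case: oM.
  rewrite -det_qmat1 -normr_eq0 -(lat_eq_det uM MX XM) normr_eq0.
  by rewrite -unitfE -unitmxE.
have MX1 : subset_q (lat M) (lat (qmat qone y z x)).
  move=> v /MX /lat_qmatP[n0 [n1 [n2 [n3 ->]]]]; apply/lat_qmatP.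
  by exists n0, n2, n3, n1; rewrite -!addrA; congr (_ + _); rewrite [LHS]addrC -addrA.
have MX2 : subset_q (lat M) (lat (qmat qone z x y)).
  move=> v /MX /lat_qmatP[n0 [n1 [n2 [n3 ->]]]]; apply/lat_qmatP.
  by exists n0, n3, n1, n2; rewrite -!addrA; congr (_ + _); rewrite [RHS]addrC -addrA.
have [l0 lx ly lz] : [/\ lat M qone, lat M x, lat M y & lat M z].
  split; apply: XM; apply/lat_qmatP;
  [exists 1, 0, 0, 0|exists 0, 1, 0, 0|exists 0, 0, 1, 0|exists 0, 0, 0, 1];
  by rewrite !scale1r !scale0r ?addr0 ?add0r.
pose N := 4%:R * a%:~R * b%:~R * vol x y z.
have N0 : N != 0 by rewrite /N !mulf_neq0 ?intr_eq0.
have N1 : 4%:R * a%:~R * b%:~R * vol y z x = N by rewrite /N; congr (_ * _); qsimp; ring.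
have N2 : 4%:R * a%:~R * b%:~R * vol z x y = N by rewrite /N; congr (_ * _); qsimp; ring.
pose l1 := qcom a b y z; pose l2 := qcom a b z x; pose l3 := qcom a b x y.
have hI : int3 a b N^-1 l1 l2 l3.
  split; split.
  - have [m] := order_com_norm oM MX1 ly lz; rewrite N1 /qn => ->.
    by rewrite mulrC mulfK // intr_int.
  - have [m] := order_com_norm oM MX2 lz lx; rewrite N2 /qn => ->.
    by rewrite mulrC mulfK // intr_int.
  - have [m] := order_com_norm oM MX lx ly; rewrite -/N /qn => ->.
    by rewrite mulrC mulfK // intr_int.
  - have [m] := order_com_dot oM MX2 lx ly; rewrite N2 /qt => ->.
    by rewrite mulrC mulfK // intr_int.
  - have [m] := order_com_dot oM MX ly lz; rewrite -/N /qt => ->.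
    by rewrite mulrC mulfK // intr_int.
  - have [m] := order_com_dot oM MX1 lz lx; rewrite N1 /qt => ->.
    by rewrite mulrC mulfK // intr_int.
have [i0 i1 i2 i3] := ord3_basis (a := a) (b := b) (s := N^-1) (l1 := l1) (l2 := l2) (l3 := l3).
(* The Clifford product equals a scalar minus x', so x' lies in the new order once that scalar is an
   integer. Its double is fixed by traces, and a quadratic relation by norms. *)
have rec x' m1 m2 c : lat M x' -> lat (ord3 a b N^-1 l1 l2 l3) (qcl a b N^-1 m1 m2) ->
    qn a b N^-1 m1 \is a Num.int -> qn a b N^-1 m2 \is a Num.int ->
    qt a b N^-1 m1 m2 \is a Num.int ->
    qmul a b m1 (qconj m2) = c *: qone - N *: x' ->
    lat (ord3 a b N^-1 l1 l2 l3) x'.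
  move=> hx' hm k1 k2 k3 hc.
  have ce : qcl a b N^-1 m1 m2 = (N^-1 * c) *: qone - x'.
    by rewrite /qcl hc scalerBr !scalerA mulVf // scale1r.
  have -> : x' = (N^-1 * c) *: qone - qcl a b N^-1 m1 m2 by rewrite ce subKr.
  apply: latB => //; apply: latZint => //.
  apply: (@half_int_quadratic _ (qtr x')); last 1 first.
  - have -> : (N^-1 * c) ^+ 2 - N^-1 * c * qtr x' =
      qnorm a b (qcl a b N^-1 m1 m2) - qnorm a b x'.
      rewrite ce !qnormE; qsimp; ring.
    by apply: rintB; [rewrite qnorm_qcl; exact: rintM|exact: (order_norm_int oM hx')].
  - have -> : 2%:R * (N^-1 * c) = qt a b N^-1 m1 m2 + qtr x'.
      rewrite -qdot_qone_qcl ce; qsimp; ring.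
    by apply: rintD; last exact: (order_tr_int oM hx').
  exact: (order_tr_int oM hx').
case: (hI) => [[I1 I2 I3] [J1 J2 J3]].
exists N^-1, l1, l2, l3; split=> // v /MX /lat_qmatP[n0 [n1 [n2 [n3 ->]]]].
do !apply: latD; apply: latZ => //.
- by have [c hc] := qcom_recover x y z; exact: (rec _ _ _ _ _ _ _ _ _ hc).
- by have [c] := qcom_recover y z x; rewrite N1 => hc; exact: (rec _ _ _ _ _ _ _ _ _ hc).
- by have [c] := qcom_recover z x y; rewrite N2 => hc; exact: (rec _ _ _ _ _ _ _ _ _ hc).
Qed.

(** Rotation, swap and shift are unimodular changes of the ternary basis; the Clifford order still
    covers [M]. They are used to bring a vector that is special modulo l into the third place. *)
Lemma covered_rot M s l1 l2 l3 : covered M s l1 l2 l3 -> covered M s l2 l3 l1.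
Proof.
case=> [[[i1 i2 i3] [j1 j2 j3]] h]; split; first by split; split.
have [b0' b1 b2 b3] := ord3_basis (a := a) (b := b) (s := s) (l1 := l2) (l2 := l3) (l3 := l1).
move=> x /h /lat_qmatP[n0 [n1 [n2 [n3 ->]]]].
by do !apply: latD; apply: latZ.
Qed.

Lemma covered_swap M s l1 l2 l3 : covered M s l1 l2 l3 -> covered M s l2 l1 l3.
Proof.
case=> [[[i1 i2 i3] [j1 j2 j3]] h].
have hI : int3 a b s l2 l1 l3 by split; split=> //; rewrite qt_sym.
split=> //; have [b0' _ _ _] := ord3_basis (a := a) (b := b) (s := s) (l1 := l2) (l2 := l1) (l3 := l3).
have [c1 c2 c3] := ord3_basis_swap hI.
move=> x /h /lat_qmatP[n0 [n1 [n2 [n3 ->]]]].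
by do !apply: latD; apply: latZ.
Qed.

Lemma qn_shift s (x y : rat) l1 l2 l3 : qn a b s (l3 + x *: l1 + y *: l2) =
  qn a b s l3 + x ^+ 2 * qn a b s l1 + y ^+ 2 * qn a b s l2
  + x * qt a b s l3 l1 + y * qt a b s l2 l3 + x * y * qt a b s l1 l2.
Proof. rewrite /qn !qnormE /qt; qsimp; ring. Qed.

Lemma qt_shift1 s (x y : rat) l1 l2 l3 : qt a b s l2 (l3 + x *: l1 + y *: l2) =
  qt a b s l2 l3 + x * qt a b s l1 l2 + 2%:R * y * qn a b s l2.
Proof. rewrite /qn !qnormE /qt; qsimp; ring. Qed.

Lemma qt_shift2 s (x y : rat) l1 l2 l3 : qt a b s (l3 + x *: l1 + y *: l2) l1 =
  qt a b s l3 l1 + 2%:R * x * qn a b s l1 + y * qt a b s l1 l2.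
Proof. rewrite /qn !qnormE /qt; qsimp; ring. Qed.

Lemma covered_shift M s l1 l2 l3 (x y : int) : covered M s l1 l2 l3 ->
  covered M s l1 l2 (l3 + x%:~R *: l1 + y%:~R *: l2).
Proof.
case=> [[[i1 i2 i3] [j1 j2 j3]] h].
set l3' := l3 + _ + _.
have xi : x%:~R \is a @Num.int rat by exact: intr_int.
have yi : y%:~R \is a @Num.int rat by exact: intr_int.
have hI : int3 a b s l1 l2 l3'.
  split; split=> //; rewrite ?qn_shift ?qt_shift1 ?qt_shift2.
  - by do !apply: rintD => //; do ?apply: rintM => //; exact: rintX.
  - by do !apply: rintD => //; do !apply: rintM => //; exact: rint_nat.
  - by do !apply: rintD => //; do !apply: rintM => //; exact: rint_nat.
split=> //; have [b0' b1 b2 b3] := ord3_basis (a := a) (b := b) (s := s) (l1 := l1) (l2 := l2) (l3 := l3').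
have e1 : qcl a b s l2 l3 = qcl a b s l2 l3' - (x%:~R * qt a b s l1 l2 + y%:~R * qn a b s l2) *: qone
    + x%:~R *: qcl a b s l1 l2.
  rewrite /l3' /qcl /qt /qn qnormE; qring.
have e2 : qcl a b s l3 l1 = qcl a b s l3' l1 - (x%:~R * qn a b s l1 + y%:~R * qt a b s l1 l2) *: qone
    + y%:~R *: qcl a b s l1 l2.
  rewrite /l3' /qcl /qt /qn qnormE; qring.
have f1 : lat (ord3 a b s l1 l2 l3') (qcl a b s l2 l3).
  rewrite e1; apply: latD; [apply: latB => //|exact: latZ].
  by apply: latZint => //; apply: rintD; apply: rintM.
have f2 : lat (ord3 a b s l1 l2 l3') (qcl a b s l3 l1).
  rewrite e2; apply: latD; [apply: latB => //|exact: latZ].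
  by apply: latZint => //; apply: rintD; apply: rintM.
move=> z /h /lat_qmatP[n0 [n1 [n2 [n3 ->]]]].
by do !apply: latD; apply: latZ.
Qed.

Section Max.
Context {M : 'M[rat]_4} (mM : is_max_order a b M).

(** The covering order cannot be strictly larger, so all ternary lattices covering a maximal order
    have the same discriminant up to sign. A cover with another discriminant is a contradiction. *)
Lemma covered_max s l1 l2 l3 : covered M s l1 l2 l3 ->
  subset_q (lat (ord3 a b s l1 l2 l3)) (lat M) /\
  `|disc3 a b s l1 l2 l3| = `|4%:R * a%:~R * b%:~R * \det M|.
Proof.
case: mM => oM maxM [hI h].
have uM : M \in unitmx by case: oM.
have nz : vol (qcl a b s l2 l3) (qcl a b s l3 l1) (qcl a b s l1 l2) != 0.
  rewrite -det_qmat1; have [Z e] := lat_subset_mx h.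
  apply/negP => /eqP h0; move: uM.
  by rewrite e unitmxE det_mulmx /ord3 h0 mulr0 unitr0.
have sub := maxM _ (ord3_order hI nz) h; split=> //.
rewrite -normrN -disc3_vol [LHS]normrM [RHS]normrM (lat_eq_det uM h sub).
by rewrite /ord3 det_qmat1.
Qed.

Lemma max_disc_neq0 : `|4%:R * a%:~R * b%:~R * \det M| != 0.
Proof.
rewrite normr_eq0 !mulf_neq0 ?intr_eq0 // -unitfE -unitmxE.
by case: mM => [[]].
Qed.

Lemma max_no_scale s l1 l2 l3 s' l1' l2' l3' (c : rat) :
  covered M s l1 l2 l3 -> covered M s' l1' l2' l3' ->
  disc3 a b s l1 l2 l3 = c * disc3 a b s' l1' l2' l3' -> `|c| = 1.
Proof.
move=> /covered_max[_ e] /covered_max[_ e'] ec.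
apply: (mulIf max_disc_neq0); rewrite mul1r -{1}e' -normrM -ec.
exact: e.
Qed.

Context {l : nat} (l_gt1 : (1 < l)%N).
Let L : rat := l%:R.
Let L0 : L != 0. Proof. by rewrite pnatr_eq0; case: (l) l_gt1. Qed.
Let L1 : `|L| <> 1.
Proof. by rewrite normr_nat => /eqP; rewrite pnatr_eq1 => /eqP h; move: l_gt1; rewrite h. Qed.

(** If the form vanishes modulo l on the plane of l1 and l3, scaling l2 by l makes the whole form
    divisible by l. Dividing it by l costs l^3 in the discriminant, the scaling of l2 returns l^2,
    so the new cover has discriminant smaller by a factor l. *)
Lemma max_no_isotropic_plane s l1 l2 l3 : covered M s l1 l2 l3 ->
  qn a b s l1 / L \is a Num.int -> qn a b s l3 / L \is a Num.int ->
  qt a b s l3 l1 / L \is a Num.int -> False.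
Proof.
move=> cov h1 h3 h31; case: (cov) => [[[i1 i2 i3] [j1 j2 j3]] h].
suff cov' : covered M (s / L) l1 (L *: l2) l3.
  apply: L1; apply: (max_no_scale cov cov').
  have e1 x : qn a b (s / L) x = qn a b s x / L by rewrite /qn; ring.
  have e2 x y : qt a b (s / L) x y = qt a b s x y / L by rewrite /qt; ring.
  have e3 x : qn a b s (L *: x) = L ^+ 2 * qn a b s x.
    by rewrite /qn !qnormE; qsimp; ring.
  have e4 x y : qt a b s (L *: x) y = L * qt a b s x y by rewrite /qt; qsimp; ring.
  have e5 x y : qt a b s x (L *: y) = L * qt a b s x y by rewrite /qt; qsimp; ring.
  by rewrite /disc3 !(e1, e2) e3 e4 e5; field.
have k1 : qn a b (s / L) (L *: l2) = L * qn a b s l2.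
  by rewrite /qn !qnormE; qsimp; field.
have k2 x y : qt a b (s / L) (L *: x) y = qt a b s x y by rewrite /qt; qsimp; field.
have k3 x y : qt a b (s / L) x (L *: y) = qt a b s x y by rewrite /qt; qsimp; field.
have Li : L \is a Num.int by rewrite -[L]/(l%:~R) intr_int.
have hI : int3 a b (s / L) l1 (L *: l2) l3.
  split; split; rewrite ?k1 ?k2 ?k3 //.
  - by move: h1; rewrite /qn mulrAC.
  - exact: rintM.
  - by move: h3; rewrite /qn mulrAC.
  - by move: h31; rewrite /qt mulrAC.
split=> //.
have [b0' b1 b2 b3] := ord3_basis (a := a) (b := b) (s := s / L) (l1 := l1) (l2 := L *: l2) (l3 := l3).
have e1 : qcl a b s l2 l3 = qcl a b (s / L) (L *: l2) l3.
  by rewrite /qcl qmulZl scalerA mulfVK.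
have e2 : qcl a b s l3 l1 = L *: qcl a b (s / L) l3 l1.
  by rewrite /qcl scalerA mulrC mulfVK.
have e3 : qcl a b s l1 l2 = qcl a b (s / L) l1 (L *: l2).
  have ec : qconj (L *: l2) = L *: qconj l2 by qring.
  by rewrite /qcl ec qmulZr scalerA mulfVK.
move=> z /h /lat_qmatP[n0 [n1 [n2 [n3 ->]]]]; rewrite e1 e2 e3.
by do !apply: latD; apply: latZ => //; apply: latZint.
Qed.

(** The vector l3 can be divided by l with the form still integral; the discriminant of the cover
    drops by l^2. *)
Lemma max_no_square s l1 l2 l3 : covered M s l1 l2 l3 ->
  qn a b s l3 / L ^+ 2 \is a Num.int -> qt a b s l2 l3 / L \is a Num.int ->
  qt a b s l3 l1 / L \is a Num.int -> False.
Proof.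
move=> cov h3 h23 h31; case: (cov) => [[[i1 i2 i3] [j1 j2 j3]] h].
have k1 x : qn a b s (L^-1 *: x) = qn a b s x / L ^+ 2.
  by rewrite /qn !qnormE; qsimp; field.
have k2 x y : qt a b s (L^-1 *: x) y = qt a b s x y / L by rewrite /qt; qsimp; field.
have k3 x y : qt a b s x (L^-1 *: y) = qt a b s x y / L by rewrite /qt; qsimp; field.
suff cov' : covered M s l1 l2 (L^-1 *: l3).
  apply: L1; apply/eqP; rewrite -(eqrXn2 (n := 2)) // -normrX expr1n; apply/eqP.
  apply: (max_no_scale cov cov').
  by rewrite /disc3 k1 k2 k3; field.
have Li : L \is a Num.int by rewrite -[L]/(l%:~R) intr_int.
split; first by split; split; rewrite ?k1 ?k2 ?k3.
have [b0' b1 b2 b3] := ord3_basis (a := a) (b := b) (s := s) (l1 := l1) (l2 := l2) (l3 := L^-1 *: l3).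
have e1 : qcl a b s l2 l3 = L *: qcl a b s l2 (L^-1 *: l3).
  have ec : qconj (L^-1 *: l3) = L^-1 *: qconj l3 by qring.
  by rewrite /qcl ec qmulZr !scalerA; congr (_ *: _); field.
have e2 : qcl a b s l3 l1 = L *: qcl a b s (L^-1 *: l3) l1.
  by rewrite /qcl qmulZl !scalerA; congr (_ *: _); field.
move=> z /h /lat_qmatP[n0 [n1 [n2 [n3 ->]]]]; rewrite e1 e2.
by do !apply: latD; apply: latZ => //; apply: latZint.
Qed.

End Max.
End MaxOrder.

(** * The reduced discriminant of a maximal order *)

Section Transfer.
Context {a b : int} {l : nat} (pl : prime l).

(** Anisotropy over Q_l in finite form, relative to a lattice. Norms are rational here, so
    divisibility by l^k is written as an equality with an integer multiple. *)
Definition aniso_lat (M : 'M[rat]_4) : Prop :=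
  exists k : nat, forall (z : 'rV[int]_4) (n : int),
    qnorm a b (map_mx intr z *m M) = (n * l%:Z ^+ k)%:~R -> forall i, (l%:Z %| z 0%R i)%Z.

Lemma mx_denom (A : 'M[rat]_4) : exists (d : int) (Z : 'M[int]_4),
  d != 0 /\ d%:~R *: A = map_mx intr Z.
Proof.
pose d : int := \prod_(ij : 'I_4 * 'I_4) denq (A ij.1 ij.2).
exists d, (\matrix_(i, j) numq (d%:~R * A i j)); split.
  by apply/prodf_neq0 => ij _; exact: denq_neq0.
have key (q : rat) (e : int) : (denq q * e)%:~R * q = (e * numq q)%:~R.
  have d0 : (denq q)%:~R != 0 :> rat by rewrite intr_eq0 denq_neq0.
  by rewrite !intrM -[X in _ * X = _]divq_num_den; field.
by apply/matrixP => i j; rewrite !mxE numqK // /d (bigD1 (i, j)) //= key intr_int.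
Qed.

Lemma qnormZ c x : qnorm a b (c *: x) = c ^+ 2 * qnorm a b x.
Proof. rewrite !qnormE ?qE; ring. Qed.

(** A factor l taken out of the vector removes l^2 from its norm, so two more powers of l in the
    norm yield one more in the vector. *)
Lemma aniso_pow (M : 'M[rat]_4) k :
  (forall (z : 'rV[int]_4) (n : int),
    qnorm a b (map_mx intr z *m M) = (n * l%:Z ^+ k)%:~R -> forall i, (l%:Z %| z 0%R i)%Z) ->
  forall m (z : 'rV[int]_4) (n : int),
    qnorm a b (map_mx intr z *m M) = (n * l%:Z ^+ (k + m.*2))%:~R ->
    forall i, (l%:Z ^+ m.+1 %| z 0%R i)%Z.
Proof.
move=> h; elim=> [|m IH] z n hz i.
  by rewrite expr1; rewrite addn0 in hz; exact: h hz i.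
have dz i' : (l%:Z %| z 0%R i')%Z.
  by apply: (h z (n * l%:Z ^+ m.+1.*2)); rewrite hz -mulrA -exprD addnC.
pose y : 'rV[int]_4 := \row_j (z 0%R j %/ l%:Z)%Z.
have zy : z = l%:Z *: y by apply/rowP => j; rewrite !mxE mulrC divzK.
have l0 : l%:Z != 0 by case: (l) pl.
rewrite zy mxE exprS dvdz_mul //; apply: (IH y n).
have lr : (l%:Z%:~R : rat) ^+ 2 != 0 by rewrite expf_neq0 // intr_eq0.
apply: (mulfI lr); rewrite -qnormZ scalemxAl -map_mxZ -zy hz expr2 -!intrM.
congr (_%:~R); rewrite doubleS !addnS !exprS; ring.
Qed.

(** The lattices are commensurable: zZ gives the [M1]-coordinates of d times z [M2], and W leads
    back to (d e) z. A high power of l dividing zZ survives the loss of the factor d e. *)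
Lemma aniso_transfer (M1 M2 : 'M[rat]_4) : M1 \in unitmx -> M2 \in unitmx ->
  aniso_lat M1 -> aniso_lat M2.
Proof.
move=> u1 u2 [k hk].
have [d [Z [d0 hZ]]] := mx_denom (M2 *m invmx M1).
have [e [W [e0 hW]]] := mx_denom (M1 *m invmx M2).
(* A crude substitute for the valuation of d e: m is nonzero and smaller than l^(m+1), so this power
   cannot divide it. *)
pose m := absz (d * e).
exists (k + m.*2)%N => z n hz i.
have x1 : map_mx intr (z *m Z) *m M1 = d%:~R *: (map_mx intr z *m M2).
  by rewrite map_mxM -hZ -scalemxAr -scalemxAl -!mulmxA mulVmx // mulmx1.
have ZW : Z *m W = (d * e)%:M.
  have inj (X Y : 'M[int]_4) : map_mx intr X = map_mx intr Y :> 'M[rat]_4 -> X = Y.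
    by move=> /matrixP XY; apply/matrixP => i' j'; have := XY i' j'; rewrite !mxE => /intr_inj.
  apply: inj.
  rewrite map_mxM -hZ -hW -scalemxAl -scalemxAr scalerA -!mulmxA.
  rewrite (mulmxA (invmx M1)) mulVmx // mul1mx mulmxV //.
  by rewrite scalemx1 -intrM; apply/matrixP => i' j'; rewrite !mxE; case: (i' == j').
have key j : (l%:Z ^+ m.+1 %| ((z *m Z) 0 j)%R)%Z.
  apply: (aniso_pow hk (n := d ^+ 2 * n)).
  by rewrite x1 qnormZ hz expr2 -!intrM mulrA.
have : (l%:Z ^+ m.+1 %| (d * e) * z 0%R i)%Z.
  have -> : (d * e) * z 0 i = \sum_j (z *m Z) 0 j * W j i.
    have -> : \sum_j (z *m Z) 0 j * W j i = (z *m Z *m W) 0 i by rewrite mxE.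
    by rewrite -mulmxA ZW mul_mx_scalar mxE.
  by apply: rpred_sum => j _; rewrite dvdz_mulr.
rewrite !dvdzE abszX abszM /= => h; apply/negPn/negP => nd.
have : (l ^ m.+1 %| m)%N.
  by rewrite -(Gauss_dvdl _ (_ : coprime (l ^ m.+1) (absz (z 0 i)))) // coprimeXl // prime_coprime.
have m0 : (0 < m)%N by rewrite absz_gt0 mulf_neq0.
move/(dvdn_leq m0); rewrite leqNgt => /negP; apply.
by apply: leq_trans (ltn_expl m (prime_gt1 pl)) _; rewrite leq_exp2l // prime_gt1.
Qed.

Lemma qnorm_inorm (z : 'rV[int]_4) :
  qnorm a b (map_mx intr z *m 1%:M) = (inorm a b (z 0 q0) (z 0 q1) (z 0 q2) (z 0 q3))%:~R.
Proof.
by rewrite mulmx1 qnormE !mxE /inorm; ring.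
Qed.

Lemma nonsplit_aniso : ~ split_at a b l -> aniso_lat 1%:M.
Proof.
move/not_all_ex_not => [k hk]; exists k => z n hz.
apply: NNPP => nz; apply: hk.
exists (z 0 q0), (z 0 q1), (z 0 q2), (z 0 q3); split.
  by apply/negP => /and4P[h0 h1 h2 h3]; apply: nz; apply: row4P.
move: hz; rewrite qnorm_inorm => /eqP; rewrite eqr_int => /eqP ->.
exact: dvdz_mull.
Qed.

Lemma aniso_nonsplit : aniso_lat 1%:M -> ~ split_at a b l.
Proof.
case=> k hk /(_ k) [v0 [v1 [v2 [v3 [/negP nv /dvdzP[n hn]]]]]].
pose z : 'rV[int]_4 := \row_t [:: v0; v1; v2; v3]`_t.
have := hk z n; rewrite qnorm_inorm !mxE /= hn => /(_ erefl) h; apply: nv.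
by have := (h q0, h q1, h q2, h q3); rewrite !mxE /= => -[[[-> ->] ->] ->].
Qed.

End Transfer.
Arguments aniso_lat a b l M : clear implicits.

(** * Local structure at the primes dividing the discriminant *)

Section MaxDisc.
Context {a b : int} (a0 : a != 0) (b0 : b != 0).

Definition covered_by M s l1 l2 l3 (A B C U V W : int) : Prop :=
  subset_q (lat M) (lat (ord3 a b s l1 l2 l3)) /\
  [/\ qn a b s l1 = A%:~R, qn a b s l2 = B%:~R & qn a b s l3 = C%:~R] /\
  [/\ qt a b s l2 l3 = U%:~R, qt a b s l3 l1 = V%:~R & qt a b s l1 l2 = W%:~R].

Lemma covered_byW M s l1 l2 l3 A B C U V W :
  covered_by M s l1 l2 l3 A B C U V W -> @covered a b M s l1 l2 l3.
Proof.
case=> h [[h1 h2 h3] [h4 h5 h6]]; split=> //.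
by split; split; rewrite ?h1 ?h2 ?h3 ?h4 ?h5 ?h6 intr_int.
Qed.

Lemma covered_byI M s l1 l2 l3 : @covered a b M s l1 l2 l3 ->
  exists A B C U V W, covered_by M s l1 l2 l3 A B C U V W.
Proof.
case=> [[[/intrP[A hA] /intrP[B hB] /intrP[C hC]] [/intrP[U hU] /intrP[V hV] /intrP[W hW]]] h].
by exists A, B, C, U, V, W.
Qed.

Lemma covered_by_rot M s l1 l2 l3 A B C U V W :
  covered_by M s l1 l2 l3 A B C U V W -> covered_by M s l2 l3 l1 B C A V W U.
Proof.
move=> h; have [_ h'] := covered_rot (covered_byW h).
by case: h => _ [[h1 h2 h3] [h4 h5 h6]].
Qed.

Lemma covered_by_swap M s l1 l2 l3 A B C U V W :
  covered_by M s l1 l2 l3 A B C U V W -> covered_by M s l2 l1 l3 B A C V U W.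
Proof.
move=> h; have [_ h'] := covered_swap (covered_byW h).
case: h => _ [[h1 h2 h3] [h4 h5 h6]]; split=> //; split=> //.
by rewrite (qt_sym l1 l3) (qt_sym l3 l2) (qt_sym l2 l1).
Qed.

Lemma covered_by_shift M s l1 l2 l3 A B C U V W (x y : int) :
  covered_by M s l1 l2 l3 A B C U V W ->
  covered_by M s l1 l2 (l3 + x%:~R *: l1 + y%:~R *: l2) A B
    (C + x ^+ 2 * A + y ^+ 2 * B + x * V + y * U + x * y * W)
    (U + x * W + 2 * y * B) (V + 2 * x * A + y * W) W.
Proof.
move=> h; have [_ h'] := covered_shift x y (covered_byW h).
case: h => _ [[h1 h2 h3] [h4 h5 h6]]; split=> //.
rewrite qn_shift qt_shift1 qt_shift2 h1 h2 h3 h4 h5 h6.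
by split; split=> //; ring.
Qed.

Lemma covered_by_disc M s l1 l2 l3 A B C U V W :
  covered_by M s l1 l2 l3 A B C U V W ->
  disc3 a b s l1 l2 l3 = (tdisc A B C U V W)%:~R.
Proof.
case=> _ [[h1 h2 h3] [h4 h5 h6]]; rewrite /disc3 /tdisc h1 h2 h3 h4 h5 h6; ring.
Qed.

Lemma covered_by_norm M s l1 l2 l3 A B C U V W (z : 'rV[int]_4) :
  covered_by M s l1 l2 l3 A B C U V W ->
  qnorm a b (map_mx intr z *m ord3 a b s l1 l2 l3) =
    (qform A B C U V W (z 0 q0) (z 0 q1) (z 0 q2) (z 0 q3))%:~R.
Proof.
case=> _ [[h1 h2 h3] [h4 h5 h6]].
rewrite mulmx_sum_row sum4 !mxE !row_qmat qnorm_ord3 h1 h2 h3 h4 h5 h6 /qform /form4; ring.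
Qed.

Section Local.
Context {M : 'M[rat]_4} (mM : is_max_order a b M) {l : nat} (pl : prime l).
Local Notation divl x := (l%:Z %| x)%Z.

(** With t inverse to z modulo l, the radical vector times t has third coordinate 1 modulo l. Adding
    its first two coordinates to l3 is a shift, after which the third vector is radical and singular
    modulo l. *)
Let normalize s l1 l2 l3 A B C U V W x y z :
  covered_by M s l1 l2 l3 A B C U V W -> ~~ divl z -> divl (tform A B C U V W x y z) ->
  divl (2 * A * x + W * y + V * z) -> divl (W * x + 2 * B * y + U * z) ->
  exists l3' C' U' V', covered_by M s l1 l2 l3' A B C' U' V' W /\
    [/\ divl C', divl U' & divl V'].
Proof.
move=> cov nz /dvdzP[f hf] /dvdzP[g hg] /dvdzP[h hh].
have [t [k e]] := dvdz_pos_inv pl nz.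
do 4!eexists; split; first exact: (covered_by_shift (t * x) (t * y) cov).
have ek : k * l%:Z = t * z - 1 by rewrite e addrC addKr.
split; apply/dvdzP.
- exists (t ^+ 2 * f - k * (2 * C + C * (k * l%:Z) + U * (t * y) + V * (t * x))).
  transitivity (t ^+ 2 * (f * l%:Z) - (k * l%:Z) * (2 * C + C * (k * l%:Z)
     + U * (t * y) + V * (t * x))); last by ring.
  rewrite -hf ek /tform; ring.
- exists (t * h - U * k).
  transitivity (t * (h * l%:Z) - U * (k * l%:Z)); last by ring.
  rewrite -hh ek; ring.
- exists (t * g - V * k).
  transitivity (t * (g * l%:Z) - V * (k * l%:Z)); last by ring.
  rewrite -hg ek; ring.
Qed.

Lemma covered_by_radical s l1 l2 l3 A B C U V W :
  covered_by M s l1 l2 l3 A B C U V W -> divl (tdisc A B C U V W) ->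
  exists l1' l2' l3' A' B' C' U' V' W', covered_by M s l1' l2' l3' A' B' C' U' V' W' /\
    [/\ divl C', divl U' & divl V'].
Proof.
move=> cov /(radical_vector pl) [x [y [z [nxyz df [d1 d2 d3]]]]].
have [dz|nz] := boolP (divl z); last first.
  have [l3' [C' [U' [V' h]]]] := normalize cov nz df d1 d2.
  by exists l1, l2, l3', A, B, C', U', V', W.
have [dy|ny] := boolP (divl y); last first.
  have := @normalize _ _ _ _ _ _ _ _ _ _ z x y (covered_by_rot (covered_by_rot cov)) ny.
  case.
  - have <- : tform A B C U V W x y z = tform C A B W U V z x y by rewrite /tform; ring.
    done.
  - have <- : V * x + U * y + 2 * C * z = 2 * C * z + V * x + U * y by ring.
    done.
  - have <- : 2 * A * x + W * y + V * z = V * z + 2 * A * x + W * y by ring.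
    done.
  move=> l3' [C' [U' [V' h]]].
  by exists l3, l1, l3', C, A, C', U', V', V.
have nx : ~~ divl x by move: nxyz; rewrite dy dz !andbT.
have := @normalize _ _ _ _ _ _ _ _ _ _ y z x (covered_by_rot cov) nx.
case.
- have <- : tform A B C U V W x y z = tform B C A V W U y z x by rewrite /tform; ring.
  done.
- have <- : W * x + 2 * B * y + U * z = 2 * B * y + U * z + W * x by ring.
  done.
- have <- : V * x + U * y + 2 * C * z = U * y + 2 * C * z + V * x by ring.
  done.
move=> l3' [C' [U' [V' h]]].
by exists l2, l3, l3', B, C, C', U', V', U.
Qed.

Let div_int (n : int) : divl n -> n%:~R / l%:R \is a @Num.int rat.
Proof. by move=> h; rewrite -[l%:R]/(l%:Z%:~R); exact: Qint_dvdz. Qed.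

(** A zero of the plane form with x a unit can be shifted into l1; together with the radical vector
    l3 it spans a plane on which the form vanishes modulo l, which maximality excludes. *)
Let no_zero s l1 l2 l3 A B C U V W x y : covered_by M s l1 l2 l3 A B C U V W ->
  divl C -> divl U -> divl V -> divl (A * x ^+ 2 + B * y ^+ 2 + W * x * y) -> divl x.
Proof.
move=> cov dC dU dV df; apply/negPn/negP => nx.
have [t [k e]] := dvdz_pos_inv pl nx.
have ek : k * l%:Z = t * x - 1 by rewrite e addrC addKr.
have := covered_by_shift (t * y) 0 (covered_by_rot cov).
move/covered_by_rot/covered_by_rot => cov'.
have dA : divl (A + (t * y) ^+ 2 * B + 0 ^+ 2 * C + t * y * W + 0 * V + t * y * 0 * U).
  case/dvdzP: df => f hf; apply/dvdzP.
  exists (t ^+ 2 * f - k * (2 * A + A * (k * l%:Z) + W * (t * y))).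
  transitivity (t ^+ 2 * (f * l%:Z) - (k * l%:Z) * (2 * A + A * (k * l%:Z) + W * (t * y)));
    last by ring.
  rewrite -hf ek; ring.
have dV' : divl (V + t * y * U + 2 * 0 * C).
  by rewrite mulr0 mul0r addr0 rpredD // dvdz_mull.
have [_ [[h1 h2 h3] [h4 h5 h6]]] := cov'.
apply: (max_no_isotropic_plane a0 b0 mM (prime_gt1 pl) (covered_byW cov')).
- by rewrite h1 div_int.
- by rewrite h3 div_int.
- by rewrite h5 div_int.
Qed.

Lemma max_order_local s l1 l2 l3 A B C U V W :
  covered_by M s l1 l2 l3 A B C U V W -> divl (tdisc A B C U V W) ->
  aniso_lat a b l M /\ ~ (l%:Z ^+ 2 %| tdisc A B C U V W)%Z.
Proof.
move=> cov dN.
have [m1 [m2 [m3 [A' [B' [C' [U' [V' [W' [cov' [dC dU dV]]]]]]]]]]] := covered_by_radical cov dN.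
have an (x y : int) : divl (A' * x ^+ 2 + B' * y ^+ 2 + W' * x * y) -> divl x /\ divl y.
  move=> df; split; first exact: no_zero cov' dC dU dV df.
  apply: (no_zero (covered_by_swap cov') dC dV dU (y := x)).
  have -> : B' * y ^+ 2 + A' * x ^+ 2 + W' * y * x = A' * x ^+ 2 + B' * y ^+ 2 + W' * x * y by ring.
  exact: df.
have [c1 hc] := dvdzP dC; have [u1 hu] := dvdzP dU; have [v1 hv] := dvdzP dV.
rewrite mulrC in hc; rewrite mulrC in hu; rewrite mulrC in hv.
have l0 : l%:R != 0 :> rat by rewrite pnatr_eq0; case: (l) pl.
have nc1 : ~ divl c1.
  case/dvdzP=> c2 hc2.
  have [_ [[h1 h2 h3] [h4 h5 h6]]] := cov'.
  apply: (max_no_square a0 b0 mM (prime_gt1 pl) (covered_byW cov')).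
  - rewrite h3 hc hc2 !intrM -[l%:Z%:~R]/(l%:R).
    have -> : l%:R * (c2%:~R * l%:R) / l%:R ^+ 2 = c2%:~R :> rat by field.
    exact: intr_int.
  - by rewrite h4 div_int.
  - by rewrite h5 div_int.
have [sub e'] := covered_max mM (covered_byW cov').
have [_ e] := covered_max mM (covered_byW cov).
have ed : `|tdisc A B C U V W| = `|tdisc A' B' C' U' V' W'|.
  apply: (intr_inj (R := rat)); rewrite !intr_norm.
  by rewrite -(covered_by_disc cov) -(covered_by_disc cov') e e'.
split; last first.
  rewrite dvdzE (_ : absz (tdisc A B C U V W) = absz (tdisc A' B' C' U' V' W')); last first.
    by apply/eqP; rewrite -eqz_nat !abszE ed.
  by rewrite -dvdzE; exact: (aniso_tdisc pl an hc hu hv nc1).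
have uM : M \in unitmx by case: mM => [[]].
have uO : ord3 a b s m1 m2 m3 \in unitmx.
  have [Z eZ] := lat_subset_mx (proj1 cov').
  by move: uM; rewrite eZ unitmxE det_mulmx unitrM -unitmxE => /andP[].
apply: (aniso_transfer pl uO uM); exists 2%N => z n.
rewrite (covered_by_norm _ cov') => /eqP; rewrite eqr_int => /eqP hq.
have := @aniso_qform _ _ _ _ _ _ _ pl an c1 u1 v1 hc hu hv nc1
   (z 0 q0) (z 0 q1) (z 0 q2) (z 0 q3).
rewrite hq dvdz_mull // => /(_ isT) /and4P[h0 h1 h2 h3].
exact: row4P.
Qed.

End Local.

Theorem max_order_disc p M : prime p -> odd p -> ramified_exactly_at_p_infty a b p ->
  is_max_order a b M -> `|4%:R * a%:~R * b%:~R * \det M| = p%:R.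
Proof.
move=> pp op [_ [_ ram]] mM; have [oM _] := mM.
have uM : M \in unitmx by case: oM.
have u1 : 1%:M \in @unitmx rat 4 by exact: unitmx1.
have [s [l1 [l2 [l3 cv]]]] := order_covered a0 b0 oM.
have [A [B [C [U [V [W cov]]]]]] := covered_byI cv.
have [sub e] := covered_max mM cv.
rewrite -e (covered_by_disc cov) -intr_norm -abszE.
set N := `|_|%N.
have N0 : (0 < N)%N.
  rewrite absz_gt0 -(intr_eq0 rat) -(covered_by_disc cov) -normr_eq0 e.
  exact: (max_disc_neq0 a0 b0 mM).
have dN (l : nat) : (l %| N)%N -> (l%:Z %| tdisc A B C U V W)%Z by rewrite dvdzE.
have only_p (l : nat) : prime l -> (l %| N)%N -> l = p.
  move=> pl /dN /(max_order_local mM pl cov) [an _].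
  by apply/(ram _ pl)/(aniso_nonsplit (a := a) (b := b))/(aniso_transfer pl uM u1 an).
have pN : (p %| N)%N.
  apply/negPn/negP => npN.
  have := nonsplit_aniso (proj2 (ram p pp) erefl).
  have uO : ord3 a b s l1 l2 l3 \in unitmx.
    have [Z eZ] := lat_subset_mx (proj1 cov).
    by move: uM; rewrite eZ unitmxE det_mulmx unitrM -unitmxE => /andP[].
  move/(aniso_transfer pp u1 uO) => [k hk].
  have nN : ~ (p%:Z %| tdisc A B C U V W)%Z by rewrite dvdzE; apply/negP.
  have [x0 [x1 [x2 [x3 [/negP nx /dvdzP[n hn]]]]]] := qform_isotropic pp op nN k.
  pose z : 'rV[int]_4 := \row_t [:: x0; x1; x2; x3]`_t.
  (* The lifted zero holds modulo p^(k+1); the spare factor p goes into the cofactor to match the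
     exponent k. *)
  apply: nx; have := hk z (n * p%:Z); rewrite (covered_by_norm z cov) !mxE /= hn.
  rewrite exprS mulrA => /(_ erefl) h.
  by have := (h q0, h q1, h q2, h q3); rewrite !mxE /= => -[[[-> ->] ->] ->].
have [_ np2] := max_order_local mM pp cov (dN _ pN).
case/dvdnP: (pN) => m Nm.
(* A prime factor of m would again be p, and p^2 would divide N. *)
have m1 : m = 1%N.
  apply/eqP; rewrite eqn_leq andbC; apply/andP; split.
    by move: N0; rewrite Nm muln_gt0 => /andP[].
  rewrite leqNgt; apply/negP => mgt; apply: np2.
  have [pq dq] := (pdiv_prime mgt, pdiv_dvd m).
  have eq : pdiv m = p by apply: only_p => //; rewrite Nm dvdn_mulr.
  by rewrite dvdzE abszX -/N Nm expnS expn1 dvdn_mul // -eq.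
by rewrite Nm m1 mul1n.
Qed.

End MaxDisc.

(** * Lattice index and determinant *)

(** In the Smith form Z = L D R the cosets are represented by a box of residues modulo the diagonal
    of D, with |det Z| elements. Injections in both directions match this box with the [r] given
    representatives. *)
Lemma index_det (M1 M2 : 'M[rat]_4) (r : nat) : M1 \in unitmx -> M2 \in unitmx ->
  index_is (lat M1) (lat M2) r -> `|\det M1| = r%:R * `|\det M2|.
Proof.
move=> u1 u2 [sub [s [_ [sT [s_neq s_ex]]]]].
have [Z eZ] := lat_subset_mx sub.
have [L uL [R uR [d _ eD]]] := int_Smith_normal_form Z.
set D := \matrix_(i, j) _ in eD.
pose dd (i : 'I_4) : int := d`_i.
have mulD (q : 'rV[int]_4) i : (q *m D) 0 i = q 0 i * dd i.
  rewrite mxE (bigD1 i) //= !mxE eqxx mulr1n big1 ?addr0 // => j ji.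
  by rewrite !mxE (negbTE (_ : (j : nat) != i)) ?mulr0n ?mulr0.
have dD : \det D = (dd q0) * (dd q1) * (dd q2) * (dd q3).
  rewrite det4E !mxE /dd /=; ring.
have dZ : absz (\det Z) = absz (\det D).
  have abs1 (X : 'M[int]_4) : X \in unitmx -> absz (\det X) = 1%N.
    by rewrite unitmxE => /unitrP [y [h _]]; move/(congr1 absz)/eqP: h;
       rewrite abszM muln_eq1 => /andP[_ /eqP].
  by rewrite eD !det_mulmx !abszM (abs1 L) // (abs1 R) // mul1n muln1.
have Z0 : \det Z != 0.
  have : \det M1 != 0 by rewrite -unitfE -unitmxE.
  by rewrite eZ det_mulmx det_intr mulf_eq0 negb_or intr_eq0 => /andP[].
have d0 (i : 'I_4) : (0 < absz (dd i))%N.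
  have : \det D != 0 by rewrite -absz_gt0 -dZ absz_gt0.
  rewrite absz_gt0 dD !mulf_eq0 !negb_or.
  by move=> /andP[/andP[/andP[h0 h1] h2] h3]; move: i; apply: row4P.
have inM1 (u : 'rV[int]_4) : lat M1 (map_mx intr u *m M2) -> exists y, u = y *m D *m R.
  case=> y; rewrite eZ mulmxA -map_mxM => /(can_inj (mulmxK u2)) /matrixP h.
  exists (y *m L); rewrite -(mulmxA y L D) -(mulmxA y (L *m D) R) -eD; apply/matrixP => i j.
  by have := h i j; rewrite !mxE => /intr_inj.
pose T := ('I_(absz (dd q0)) * 'I_(absz (dd q1)) * 'I_(absz (dd q2)) * 'I_(absz (dd q3)))%type.
pose row (t : T) : 'rV[int]_4 :=
  \row_i [:: (t.1.1.1 : nat)%:Z; (t.1.1.2 : nat)%:Z; (t.1.2 : nat)%:Z; (t.2 : nat)%:Z]`_i.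
pose rep (t : T) : quat := map_mx intr (row t *m R) *m M2.
have rep_in t : lat M2 (rep t) by exists (row t *m R).
have small (m e e' : nat) (q : int) : (e < m)%N -> (e' < m)%N -> e%:Z - e'%:Z = q -> (m %| absz q)%N -> e = e'.
  move=> h h' <-; rewrite -[m]/(absz m%:Z) -dvdzE -eqz_mod_dvd => /eqP.
  by rewrite !modz_small ?ltz_nat ?h ?h' //= => -[].
have rep_inj t t' : lat M1 (rep t - rep t') -> t = t'.
  rewrite /rep -mulmxBl -map_mxB -mulmxBl => /inM1 [y].
  move/(can_inj (mulmxK uR)) => h.
  have {}h i : (absz (dd i) %| absz ((row t - row t') 0 i)%R)%N.
    by rewrite h mulD abszM dvdn_mull.
  have := (h q0, h q1, h q2, h q3); rewrite !mxE /= => -[[[h0 h1] h2] h3].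
  move: t t' h0 h1 h2 h3 {h} => [[[a0 a1] a2] a3] [[[b0 b1] b2] b3] /= h0 h1 h2 h3.
  by congr (_, _, _, _); apply: val_inj => /=;
    [apply: (small _ _ _ _ _ _ erefl h0)|apply: (small _ _ _ _ _ _ erefl h1)|apply: (small _ _ _ _ _ _ erefl h2)|apply: (small _ _ _ _ _ _ erefl h3)].
have rep_ex x : lat M2 x -> exists t, lat M1 (x - rep t).
  case=> z ->; pose u := z *m invmx R.
  have mlt (i : 'I_4) : (absz (u 0%R i %% dd i)%Z < absz (dd i))%N.
    rewrite -ltz_nat !abszE [X in X < _]ger0_norm; last first.
      by rewrite modz_ge0 // -absz_gt0.
    by rewrite ltz_mod // -absz_gt0.
  exists (Ordinal (mlt q0), Ordinal (mlt q1), Ordinal (mlt q2), Ordinal (mlt q3)).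
  set t := (X in rep X).
  pose q : 'rV[int]_4 := \row_i (u 0%R i %/ dd i)%Z.
  have eu : u - row t = q *m D.
    apply/rowP => i; rewrite mulD.
    have hr : row t 0 i = (u 0%R i %% dd i)%Z.
      rewrite mxE; move: i; apply: row4P;
      by rewrite /= abszE ger0_norm // modz_ge0 // -absz_gt0.
    transitivity (u 0 i - row t 0 i); first by rewrite !mxE.
    by rewrite hr [q 0 i]mxE {1}(divz_eq (u 0 i) (dd i)) addrK.
  exists (q *m invmx L); rewrite eZ mulmxA -map_mxM /rep -mulmxBl -map_mxB.
  congr (map_mx _ _ *m _); rewrite eD !mulmxA mulmxKV // -eu mulmxBl /u.
  by rewrite mulmxKV.
have cT : #|{: T}| = absz (\det Z).
  by rewrite dZ dD !abszM !card_prod !card_ord.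
have ex1 (t : T) : exists i : 'I_r, lat M1 (rep t - nth 0 s i).
  by have [i ir h] := s_ex _ (rep_in t); exists (Ordinal ir).
have [g hg] := fin_all_exists ex1.
have g_inj : injective g.
  move=> t t' e; apply: rep_inj.
  have -> : rep t - rep t' = (rep t - nth 0 s (g t)) - (rep t' - nth 0 s (g t')).
    by rewrite e opprB addrA subrK.
  exact: latB.
have ex2 (i : 'I_r) : exists t, lat M1 (nth 0 s i - rep t) by apply/rep_ex/sT.
have [f hf] := fin_all_exists ex2.
have f_inj : injective f.
  move=> i j e; apply/eqP/negPn/negP => ij.
  apply: (s_neq i j) => //; first by move=> h; move: ij; rewrite (val_inj h) eqxx.
  have -> : nth 0 s i - nth 0 s j = (nth 0 s i - rep (f i)) - (nth 0 s j - rep (f j)).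
    by rewrite e opprB addrA subrK.
  exact: latB.
have er : r = absz (\det Z).
  apply/eqP; rewrite eqn_leq -cT.
  by have := (leq_card f f_inj, leq_card g g_inj); rewrite !card_ord => -[-> ->].
by rewrite eZ det_mulmx normrM det_intr -intr_norm -abszE -er.
Qed.

(** * Successive minima in rank three *)

Lemma row_free_lin n (f : 'I_n -> quat) : row_free (\matrix_t f t) <->
  forall c : 'I_n -> rat, \sum_t c t *: f t = 0 -> forall t, c t = 0.
Proof.
split=> [/row_free_inj h c hc t|h].
  have : (\row_t c t) *m (\matrix_t f t) = 0 *m (\matrix_t f t).
    rewrite mul0mx mulmx_sum_row -[RHS]hc; apply: eq_bigr => i _.
    by rewrite rowK mxE.
  by move/h/rowP/(_ t); rewrite !mxE.
apply/inj_row_free => c hc; apply/rowP => t; rewrite mxE.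
apply: (h (fun t => c 0 t)); rewrite -[RHS]hc mulmx_sum_row.
by apply: eq_bigr => i _; rewrite rowK.
Qed.

Lemma exists_notin_span n (f : 'I_n.+1 -> quat) (g : 'I_n -> quat) :
  row_free (\matrix_t f t) -> exists t, ~ exists c : 'I_n -> rat, f t = \sum_i c i *: g i.
Proof.
move=> fr; apply: NNPP => h.
have sub : (\matrix_t f t <= \matrix_i g i)%MS.
  apply/row_subP => t; rewrite rowK.
  have [c ->] : exists c : 'I_n -> rat, f t = \sum_i c i *: g i.
    by apply: NNPP => h'; apply: h; exists t.
  apply: summx_sub => i _; apply: scalemx_sub.
  by rewrite -[g i](rowK g i) row_sub.
move: fr; rewrite /row_free => /eqP e.
by have := leq_trans (mxrankS sub) (rank_leq_row _); rewrite e ltnn.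
Qed.

Definition indep1 (v : quat) := forall c : rat, c *: v = 0 -> c = 0.
Definition indep2 (v1 v2 : quat) := forall c1 c2 : rat, c1 *: v1 + c2 *: v2 = 0 ->
  c1 = 0 /\ c2 = 0.
Definition indep3 (v1 v2 v3 : quat) := forall c1 c2 c3 : rat,
  c1 *: v1 + c2 *: v2 + c3 *: v3 = 0 -> [/\ c1 = 0, c2 = 0 & c3 = 0].

Lemma indep1_row_free v : indep1 v -> row_free (\matrix_(t < 1) v).
Proof. by move=> h; apply/row_free_lin => c; rewrite big_ord1 => /h e t; rewrite (ord1 t). Qed.

Lemma indep2_row_free v1 v2 : indep2 v1 v2 ->
  row_free (\matrix_(t < 2) [:: v1; v2]`_t).
Proof.
move=> h; apply/row_free_lin => c; rewrite !big_ord_recl big_ord0 addr0 /= => /h [e1 e2].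
by case=> [[|[|//]] i]; [rewrite -[RHS]e1|rewrite -[RHS]e2]; congr c; exact: val_inj.
Qed.

Lemma indep3_row_free v1 v2 v3 : indep3 v1 v2 v3 ->
  row_free (\matrix_(t < 3) [:: v1; v2; v3]`_t).
Proof.
move=> h; apply/row_free_lin => c; rewrite !big_ord_recl big_ord0 addr0 addrA /= => /h [e1 e2 e3].
by case=> [[|[|[|//]]] i]; [rewrite -[RHS]e1|rewrite -[RHS]e2|rewrite -[RHS]e3];
  congr c; exact: val_inj.
Qed.

Lemma indep2_ext v1 w : indep1 v1 -> ~ (exists c : 'I_1 -> rat, w = \sum_i c i *: v1) ->
  indep2 v1 w.
Proof.
move=> h1 hw c1 c2 e; have [c20|c20] := eqVneq c2 0.
  by move: e; rewrite c20 scale0r addr0 => /h1.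
case: hw; exists (fun _ => - (c1 / c2)); rewrite big_ord1.
apply: (scalerI c20); rewrite scalerA mulrN mulrCA mulfV // mulr1 scaleNr.
by apply/eqP; rewrite -addr_eq0 addrC e.
Qed.

Lemma indep3_ext v1 v2 w : indep2 v1 v2 ->
  ~ (exists c : 'I_2 -> rat, w = \sum_i c i *: [:: v1; v2]`_i) -> indep3 v1 v2 w.
Proof.
move=> h1 hw c1 c2 c3 e; have [c30|c30] := eqVneq c3 0.
  by move: e; rewrite c30 scale0r addr0 => /h1 [].
case: hw; exists (fun i => [:: - (c1 / c3); - (c2 / c3)]`_i).
rewrite !big_ord_recl big_ord0 addr0 /=.
have d x : c3 * (x / c3) = x by rewrite mulrCA mulfV // mulr1.
apply: (scalerI c30); rewrite scalerDr !scalerA !mulrN !d !scaleNr.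
have e' : c3 *: w = - (c1 *: v1 + c2 *: v2) by apply/eqP; rewrite -addr_eq0 addrC e.
by rewrite e' opprD.
Qed.

Section Minima.
Context {a b : int} {Lam : quat -> Prop} {D1 D2 D3 : rat}.
Hypothesis D12 : D1 <= D2.
Hypotheses (m1 : succ_min a b Lam 1 D1) (m2 : succ_min a b Lam 2 D2)
  (m3 : succ_min a b Lam 3 D3).

Let ge1 w : Lam w -> indep1 w -> D1 <= qnorm a b w.
Proof.
move=> lw iw; apply: (proj2 m1); exists (fun _ => w); split=> //.
exact: indep1_row_free.
Qed.

Let ge2 v w : Lam v -> Lam w -> indep2 v w -> D2 <= Num.max (qnorm a b v) (qnorm a b w).
Proof.
move=> lv lw iw; apply: (proj2 m2); exists (fun t => [:: v; w]`_t); split.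
  by case=> [[|[|//]] i] /=; split; rewrite // le_max lexx ?orbT.
exact: indep2_row_free.
Qed.

Let ge3 u v w : Lam u -> Lam v -> Lam w -> indep3 u v w ->
  D3 <= Num.max (Num.max (qnorm a b u) (qnorm a b v)) (qnorm a b w).
Proof.
move=> lu lv lw iw; apply: (proj2 m3); exists (fun t => [:: u; v; w]`_t); split.
  by case=> [[|[|[|//]]] i] /=; split; rewrite // !le_max lexx ?orbT.
exact: indep3_row_free.
Qed.

(** Greedy choice: a witness family of the i-th minimum has a member outside the span of the vectors
    already chosen. The bounds then hold for any single vector independent of the chosen ones, which
    is the form used for reduction. *)
Lemma minima_vectors : exists v1 v2 v3 : quat,
  [/\ Lam v1, Lam v2 & Lam v3] /\
  [/\ qnorm a b v1 = D1, qnorm a b v2 = D2 & qnorm a b v3 = D3] /\ indep3 v1 v2 v3 /\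
  [/\ forall w, Lam w -> indep1 w -> D1 <= qnorm a b w,
      forall w, Lam w -> indep2 v1 w -> D2 <= qnorm a b w
    & forall w, Lam w -> indep3 v1 v2 w -> D3 <= qnorm a b w].
Proof.
have [f [hf /row_free_lin frf]] := proj1 m1.
have i1 : indep1 (f ord0).
  by move=> c hc; apply: (frf (fun _ => c)); [rewrite big_ord1|exact: ord0].
have [l1 n1] := hf ord0; set v1 := f ord0 in i1 l1 n1.
have e1 : qnorm a b v1 = D1 by apply/le_anti; rewrite n1 ge1.
have g2 w : Lam w -> indep2 v1 w -> D2 <= qnorm a b w.
  move=> lw iw; have := ge2 l1 lw iw; rewrite e1 le_max => /orP[h|//].
  apply: (le_trans h); apply: ge1 => // c hc.
  by have [] := iw 0 c; first by rewrite hc scale0r addr0.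
have [f2 [hf2 fr2]] := proj1 m2.
have [t2 ht2] := exists_notin_span (fun _ => v1) fr2.
have i2 := indep2_ext i1 ht2; have [l2 n2] := hf2 t2; set v2 := f2 t2 in i2 l2 n2.
have e2 : qnorm a b v2 = D2 by apply/le_anti; rewrite n2 g2.
have g3 w : Lam w -> indep3 v1 v2 w -> D3 <= qnorm a b w.
  move=> lw iw; have := ge3 l1 l2 lw iw; rewrite e1 e2 (max_idPr D12) le_max => /orP[h|//].
  apply: (le_trans h); apply: g2 => // c1 c2 hc.
  by have [] := iw c1 0 c2; first by rewrite scale0r addr0.
have [f3 [hf3 fr3]] := proj1 m3.
have [t3 ht3] := exists_notin_span (fun i : 'I_2 => [:: v1; v2]`_i) fr3.
have i3 := indep3_ext i2 ht3; have [l3 n3] := hf3 t3; set v3 := f3 t3 in i3 l3 n3.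
have e3 : qnorm a b v3 = D3 by apply/le_anti; rewrite n3 g3.
by exists v1, v2, v3.
Qed.

End Minima.

Lemma nearest_int (x : rat) : exists n : int, (x - n%:~R) ^+ 2 <= 1 / 4%:R.
Proof.
exists (Num.floor (x + 1 / 2%:R)).
have := Num.Theory.floor_le (x + 1 / 2%:R); have := Num.Theory.floorD1_gt (x + 1 / 2%:R).
rewrite intrD; move: (Num.floor _)%:~R => y h1 h2.
suff : 0 <= (1 / 2%:R - (x - y)) * (1 / 2%:R + (x - y)) by lra.
by apply: mulr_ge0; lra.
Qed.

(** * Ternary lattices with a basis of minimal vectors *)

Section Reduced.
Context {a b : int} (an : a < 0) (bn : b < 0).
Context {Lam : quat -> Prop} {v1 v2 v3 : quat} {D1 D2 D3 : rat}.
Hypotheses (LamD : forall x y, Lam x -> Lam y -> Lam (x + y))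
  (LamZ : forall (n : int) x, Lam x -> Lam (n%:~R *: x))
  (pure : forall x, Lam x -> x 0 q0 = 0).
Hypotheses (l1 : Lam v1) (l2 : Lam v2) (l3 : Lam v3).
Hypotheses (n1 : qnorm a b v1 = D1) (n2 : qnorm a b v2 = D2) (n3 : qnorm a b v3 = D3).
Hypotheses (i3 : indep3 v1 v2 v3) (D12 : D1 <= D2) (D23 : D2 <= D3).
Hypotheses (g1 : forall w, Lam w -> indep1 w -> D1 <= qnorm a b w)
  (g2 : forall w, Lam w -> indep2 v1 w -> D2 <= qnorm a b w)
  (g3 : forall w, Lam w -> indep3 v1 v2 w -> D3 <= qnorm a b w).

Let g12 := qdot a b v1 v2.
Let g13 := qdot a b v1 v3.
Let g23 := qdot a b v2 v3.
Let E2 := D1 * D2 - g12 ^+ 2.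
Let De := D1 * D2 * D3 + 2%:R * g12 * g13 * g23 - D1 * g23 ^+ 2 - D2 * g13 ^+ 2 - D3 * g12 ^+ 2.

Let Ar : (a%:~R : rat) < 0. Proof. by rewrite ltrz0. Qed.
Let Br : (b%:~R : rat) < 0. Proof. by rewrite ltrz0. Qed.

Lemma qnorm_ge0 x : 0 <= qnorm a b x.
Proof.
have h : 0 < (a%:~R : rat) * b%:~R by rewrite nmulr_rgt0.
have sq (y : rat) : 0 <= y ^+ 2 by exact: sqr_ge0.
have s0 := sq (x 0 q0).
have p1 : 0 <= - a%:~R * x 0 q1 ^+ 2 by rewrite mulr_ge0 // oppr_ge0 ltW.
have p2 : 0 <= - b%:~R * x 0 q2 ^+ 2 by rewrite mulr_ge0 // oppr_ge0 ltW.
have p3 : 0 <= a%:~R * b%:~R * x 0 q3 ^+ 2 by rewrite mulr_ge0 // ltW.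
by rewrite qnormE; lra.
Qed.

Lemma qnorm_eq0 x : qnorm a b x = 0 -> x = 0.
Proof.
have : 0 < (a%:~R : rat) * b%:~R by rewrite nmulr_rgt0.
rewrite qnormE => h e.
have sq (y : rat) : 0 <= y ^+ 2 by exact: sqr_ge0.
have s0 := sq (x 0 q0); have s1 := sq (x 0 q1); have s2 := sq (x 0 q2); have s3 := sq (x 0 q3).
have p1 : 0 <= - a%:~R * x 0 q1 ^+ 2 by rewrite mulr_ge0 // oppr_ge0 ltW.
have p2 : 0 <= - b%:~R * x 0 q2 ^+ 2 by rewrite mulr_ge0 // oppr_ge0 ltW.
have p3 : 0 <= a%:~R * b%:~R * x 0 q3 ^+ 2 by rewrite mulr_ge0 // ltW.
have z0 : x 0 q0 ^+ 2 = 0 by lra.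
have z1 : a%:~R * x 0 q1 ^+ 2 = 0 by lra.
have z2 : b%:~R * x 0 q2 ^+ 2 = 0 by lra.
have z3 : a%:~R * b%:~R * x 0 q3 ^+ 2 = 0 by lra.
have nz (c y : rat) : c != 0 -> c * y ^+ 2 = 0 -> y = 0.
  by move=> c0 /eqP; rewrite mulf_eq0 (negbTE c0) /= sqrf_eq0 => /eqP.
apply: quatP; rewrite zeroqE.
- by apply/eqP; rewrite -sqrf_eq0 z0.
- by apply: nz z1; rewrite lt_eqF.
- by apply: nz z2; rewrite lt_eqF.
- by apply: nz z3; rewrite gt_eqF.
Qed.

Let comb (y1 y2 y3 : rat) := y1 *: v1 + y2 *: v2 + y3 *: v3.

Let qnorm_comb y1 y2 y3 : qnorm a b (comb y1 y2 y3) =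
  D1 * y1 ^+ 2 + D2 * y2 ^+ 2 + D3 * y3 ^+ 2 + 2%:R * g12 * y1 * y2 + 2%:R * g13 * y1 * y3
  + 2%:R * g23 * y2 * y3.
Proof. rewrite -n1 -n2 -n3 /g12 /g13 /g23 /comb !qnormE; qsimp; ring. Qed.

Let comb_pos y1 y2 y3 : [|| y1 != 0, y2 != 0 | y3 != 0] -> 0 < qnorm a b (comb y1 y2 y3).
Proof.
move=> h; rewrite lt_neqAle qnorm_ge0 andbT eq_sym; apply/negP => /eqP /qnorm_eq0 /i3 [e1 e2 e3].
by move: h; rewrite e1 e2 e3 !eqxx.
Qed.

Let D1pos : 0 < D1.
Proof.
have := @comb_pos 1 0 0; rewrite oner_eq0 => /(_ isT); rewrite qnorm_comb; lra.
Qed.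

Let E2pos : 0 < E2.
Proof.
(* This is [D1] times the part of [v2] orthogonal to [v1]. *)
have := @comb_pos (- g12) D1 0; rewrite (gt_eqF D1pos) /= orbT => /(_ isT).
have -> : qnorm a b (comb (- g12) D1 0) = D1 * E2 by rewrite qnorm_comb /E2; ring.
by rewrite pmulr_rgt0.
Qed.

Let Depos : 0 < De.
Proof.
(* Cofactors of the Gram matrix: this is [E2] times the part of [v3] orthogonal to [v1] and [v2]. *)
have := @comb_pos (g12 * g23 - D2 * g13) (g12 * g13 - D1 * g23) E2.
rewrite (gt_eqF E2pos) /= !orbT => /(_ isT).
have -> : qnorm a b (comb (g12 * g23 - D2 * g13) (g12 * g13 - D1 * g23) E2) = E2 * De.
  rewrite qnorm_comb /E2 /De; ring.
by rewrite pmulr_rgt0.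
Qed.

(** Gram-Schmidt coefficient of [v3] along the orthogonalized [v2]; the squared lengths of the
    orthogonalized vectors are [D1], [E2 / D1] and [De / E2]. *)
Let mu := (D1 * g23 - g12 * g13) / E2.

Let qnorm_gs y1 y2 y3 : qnorm a b (comb y1 y2 y3) =
  D1 * (y1 + (g12 * y2 + g13 * y3) / D1) ^+ 2 + E2 / D1 * (y2 + mu * y3) ^+ 2
  + De / E2 * y3 ^+ 2.
Proof.
have d1 : D1 != 0 by rewrite gt_eqF.
have e2 : D1 * D2 - g12 ^+ 2 != 0 by rewrite gt_eqF.
rewrite qnorm_comb /mu /De /E2; field.
by rewrite d1 e2.
Qed.

Let E2D : E2 / D1 <= D2.
Proof.
rewrite ler_pdivrMr // /E2; have := sqr_ge0 g12; lra.
Qed.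

Let DeD : De / E2 <= D3.
Proof.
have e' : qnorm a b (comb 0 0 1) = D3 by rewrite qnorm_comb; ring.
have := qnorm_gs 0 0 1; rewrite e' expr1n.
have : 0 <= D1 * (0 + (g12 * 0 + g13 * 1) / D1) ^+ 2 by rewrite mulr_ge0 ?sqr_ge0 // ltW.
have : 0 <= E2 / D1 * (0 + mu * 1) ^+ 2 by rewrite mulr_ge0 ?sqr_ge0 ?divr_ge0 // ltW.
lra.
Qed.

Let Lam_comb (k1 k2 k3 : int) : Lam (comb k1%:~R k2%:~R k3%:~R).
Proof. by do !apply: LamD; exact: LamZ. Qed.

Let comb_indep1 y1 : y1 != 0 -> indep1 (comb y1 0 0).
Proof.
move=> h c; rewrite /comb !scale0r !addr0 scalerA => e.
have [] := i3 (c1 := c * y1) (c2 := 0) (c3 := 0); first by rewrite e !scale0r !addr0.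
by move/eqP; rewrite mulf_eq0 (negbTE h) orbF => /eqP.
Qed.

Let comb_indep2 y1 y2 : y2 != 0 -> indep2 v1 (comb y1 y2 0).
Proof.
move=> h c1 c2 e; have [] := i3 (c1 := c1 + c2 * y1) (c2 := c2 * y2) (c3 := 0).
  by rewrite -[RHS]e /comb !scale0r !addr0 scalerDl scalerDr !scalerA addrA.
move=> e1 /eqP; rewrite mulf_eq0 (negbTE h) orbF => /eqP c20 _.
by move: e1; rewrite c20 mul0r addr0.
Qed.

Let comb_indep3 y1 y2 y3 : y3 != 0 -> indep3 v1 v2 (comb y1 y2 y3).
Proof.
move=> h c1 c2 c3 e.
have [] := i3 (c1 := c1 + c3 * y1) (c2 := c2 + c3 * y2) (c3 := c3 * y3).
  by rewrite -[RHS]e /comb; apply: quatP; rewrite ?qE; ring.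
move=> e1 e2 /eqP; rewrite mulf_eq0 (negbTE h) orbF => /eqP c30.
by move: e1 e2; rewrite c30 !mul0r !addr0.
Qed.

(** Adding or subtracting an earlier vector cannot make a minimal vector shorter. *)
Lemma reduced_dot_le : [/\ `|2%:R * g12| <= D1, `|2%:R * g13| <= D1 & `|2%:R * g23| <= D2].
Proof.
have i1 : (1 : rat) != 0 by rewrite oner_eq0.
have k12 (e : int) : D2 <= qnorm a b (comb e%:~R 1 0).
  have l : Lam (comb e%:~R 1 0) := Lam_comb e 1 0.
  apply: (g2 l); exact: (@comb_indep2 _ _ i1).
have k13 (e : int) : D3 <= qnorm a b (comb e%:~R 0 1).
  have l : Lam (comb e%:~R 0 1) := Lam_comb e 0 1.
  apply: (g3 l); exact: (@comb_indep3 _ _ _ i1).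
have k23 (e : int) : D3 <= qnorm a b (comb 0 e%:~R 1).
  have l : Lam (comb 0 e%:~R 1) := Lam_comb 0 e 1.
  apply: (g3 l); exact: (@comb_indep3 _ _ _ i1).
have := (k12 1, k12 (- 1), (k13 1, k13 (- 1)), (k23 1, k23 (- 1))).
rewrite !qnorm_comb rmorphN1 /= => -[[[h1 h2] [h3 h4]] [h5 h6]].
by rewrite !ler_norml; split; apply/andP; split; lra.
Qed.

(** Rounding Gram-Schmidt coordinates from the last to the first leaves a remainder of norm at most
    (D1 + D2 + D3)/4, below [D3], so its last coordinate is 0. The same argument with two terms,
    then one, kills the others. *)
Lemma reduced_span w : Lam w -> exists k1 k2 k3 : int,
  w = k1%:~R *: v1 + k2%:~R *: v2 + k3%:~R *: v3.
Proof.
move=> lw.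
have [y1 [y2 [y3 wE]]] : exists y1 y2 y3, w = comb y1 y2 y3.
  (* Pure vectors fill only three dimensions; adding 1 gives a square matrix, and the coordinate on
     1 then vanishes. *)
  have u : qmat qone v1 v2 v3 \in unitmx.
    rewrite unitmxE unitfE; apply/negP => /det0P [c c0].
    rewrite mulmx_sum_row sum4 !row_qmat => e.
    have e0 : c 0 q0 = 0.
      have /rowP /(_ q0) := e; rewrite /qone ?qE (pure l1) (pure l2) (pure l3) !mulr0 !addr0 mulr1 //.
    have [] := i3 (c1 := c 0 q1) (c2 := c 0 q2) (c3 := c 0 q3).
      by rewrite -[RHS]e e0 scale0r add0r.
    move=> e1 e2 e3; case/eqP: c0; apply: quatP; rewrite zeroqE //.
  pose c := w *m invmx (qmat qone v1 v2 v3).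
  have wc : w = c 0 q0 *: qone + c 0 q1 *: v1 + c 0 q2 *: v2 + c 0 q3 *: v3.
    by rewrite -{1}[w](mulmxKV u) mulmx_sum_row sum4 !row_qmat.
  have e0 : c 0 q0 = 0.
    have := pure lw; rewrite {1}wc /qone ?qE (pure l1) (pure l2) (pure l3) !mulr0 !addr0 mulr1 //.
  by exists (c 0 q1), (c 0 q2), (c 0 q3); rewrite {1}wc e0 scale0r add0r.
have [m3 h3] := nearest_int y3.
have [m2 h2] := nearest_int (y2 + mu * (y3 - m3%:~R)).
have [m1 h1] := nearest_int (y1 + (g12 * (y2 - m2%:~R) + g13 * (y3 - m3%:~R)) / D1).
set z1 := y1 - m1%:~R; set z2 := y2 - m2%:~R; set z3 := y3 - m3%:~R.
have lz : Lam (comb z1 z2 z3).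
  have -> : comb z1 z2 z3 = w + comb (- m1)%:~R (- m2)%:~R (- m3)%:~R.
    by rewrite wE /comb !rmorphN /z1 /z2 /z3; apply: quatP; rewrite ?qE; ring.
  exact: LamD.
have b1 : (z1 + (g12 * z2 + g13 * z3) / D1) ^+ 2 <= 1 / 4%:R.
  by move: h1; rewrite -/z2 -/z3 addrAC.
have b2 : (z2 + mu * z3) ^+ 2 <= 1 / 4%:R by move: h2; rewrite -/z3 addrAC.
have c1 : D1 * (z1 + (g12 * z2 + g13 * z3) / D1) ^+ 2 <= D1 / 4%:R.
  by have := ler_wpM2l (ltW D1pos) b1; rewrite div1r.
have E2D0 : 0 <= E2 / D1 by rewrite divr_ge0 // ltW.
have DeE0 : 0 <= De / E2 by rewrite divr_ge0 // ltW.
have c2 : E2 / D1 * (z2 + mu * z3) ^+ 2 <= D2 / 4%:R.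
  apply: le_trans (ler_wpM2l E2D0 b2) _; rewrite div1r.
  by apply: ler_wpM2r.
have c3 : De / E2 * z3 ^+ 2 <= D3 / 4%:R.
  apply: le_trans (ler_wpM2l DeE0 h3) _; rewrite div1r.
  by apply: ler_wpM2r.
have z30 : z3 = 0.
  apply/eqP/negPn/negP => nz; have := g3 lz (@comb_indep3 _ _ _ nz).
  rewrite qnorm_gs; move: c1 c2 c3 D1pos D12 D23.
  move: (D1 * (_ + _) ^+ 2) (E2 / D1 * _ ^+ 2) (De / E2 * _ ^+ 2) => t1 t2 t3; lra.
have z20 : z2 = 0.
  apply/eqP/negPn/negP => nz; rewrite z30 in lz c1 c2.
  have := g2 lz (@comb_indep2 _ _ nz).
  rewrite qnorm_gs [0 ^+ 2]expr0n /= [De / E2 * 0]mulr0; move: c1 c2 D1pos D12.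
  move: (D1 * (_ + _) ^+ 2) (E2 / D1 * _ ^+ 2) => t1 t2; lra.
have z10 : z1 = 0.
  apply/eqP/negPn/negP => nz; rewrite z30 z20 in lz c1 c2.
  have := g1 lz (@comb_indep1 _ nz).
  have e : E2 / D1 * (0 + mu * 0) ^+ 2 + De / E2 * 0 ^+ 2 = 0 by ring.
  rewrite qnorm_gs -addrA e; move: c1 D1pos; move: (D1 * (_ + _) ^+ 2) => t1; lra.
exists m1, m2, m3; rewrite wE /comb.
by rewrite -[y1](subrK m1%:~R) -[y2](subrK m2%:~R) -[y3](subrK m3%:~R) -/z1 -/z2 -/z3
  z10 z20 z30 !add0r.
Qed.

(** Reducing [v3] by rounding gives D3 <= De/E2 + D2/4 + D1/4, hence De/E2 >= D3/2. With E2 >= 3/4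
    D1 D2 the factor 3/8 results. *)
Lemma reduced_det_ge : 3%:R * (D1 * D2 * D3) <= 8%:R * De.
Proof.
have [m2 h2] := nearest_int mu.
have [m1 h1] := nearest_int ((g12 * - m2%:~R + g13) / D1).
have i1 : (1 : rat) != 0 by rewrite oner_eq0.
have l : Lam (comb (- m1)%:~R (- m2)%:~R 1) := Lam_comb (- m1) (- m2) 1.
have := g3 l (@comb_indep3 _ _ _ i1).
have -> : qnorm a b (comb (- m1)%:~R (- m2)%:~R 1) =
  D1 * ((g12 * - m2%:~R + g13) / D1 - m1%:~R) ^+ 2 + E2 / D1 * (mu - m2%:~R) ^+ 2 + De / E2.
  by rewrite qnorm_gs !rmorphN /=; ring.
move=> k.
have c1 := ler_wpM2l (ltW D1pos) h1.
have E2D0 : 0 <= E2 / D1 by rewrite divr_ge0 // ltW.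
have c2 := ler_wpM2l E2D0 h2.
have k' : D3 / 2%:R <= De / E2.
  have e1 : D1 * (1 / 4%:R) <= D3 / 4%:R by move: D12 D23; lra.
  have e2 : E2 / D1 * (1 / 4%:R) <= D3 / 4%:R by move: E2D D23; lra.
  move: k c1 c2 e1 e2.
  move: (D1 * (_ - _) ^+ 2) (E2 / D1 * _ ^+ 2) (De / E2) => t1 t2 t3; lra.
have k2 : D3 * E2 <= 2%:R * De by move: k'; rewrite ler_pdivlMr // ; lra.
have [/ler_normlP [b1 b2] _ _] := reduced_dot_le.
have k3 : 3%:R / 4%:R * (D1 * D2) <= E2.
  have : 0 <= (D1 - 2%:R * g12) * (D1 + 2%:R * g12) by apply: mulr_ge0; lra.
  have : D1 * D1 <= D1 * D2 by rewrite ler_wpM2l // ltW.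
  rewrite /E2; lra.
have D3pos : 0 <= D3 by move: D1pos D12 D23; lra.
have := ler_wpM2l D3pos k3; lra.
Qed.

Lemma gram_det : De = a%:~R ^+ 2 * b%:~R ^+ 2 * vol v1 v2 v3 ^+ 2.
Proof.
rewrite /De -n1 -n2 -n3 /g12 /g13 /g23 !qnormE; qsimp; rewrite (pure l1) (pure l2) (pure l3); ring.
Qed.

End Reduced.

(** * Gross lattices and isometries *)

Definition gvec (x : quat) : quat := 2%:R *: x - qtr x *: qone.

Lemma grossD O x y : (forall u v, O u -> O v -> O (u + v)) -> gross O x -> gross O y ->
  gross O (x + y).
Proof.
move=> OD [u [hu ->]] [v [hv ->]]; exists (u + v); split; first exact: OD.
qring.
Qed.

Lemma grossZ M (n : int) x : gross (lat M) x -> gross (lat M) (n%:~R *: x).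
Proof.
case=> u [hu ->]; exists (n%:~R *: u); split; first exact: latZ.
qring.
Qed.

Lemma gross_pure O x : gross O x -> x 0 q0 = 0.
Proof. case=> u [_ ->]; qsimp; ring. Qed.

Lemma gvec_norm a b x : qnorm a b (gvec x) = 4%:R * qnorm a b x - qtr x ^+ 2.
Proof. rewrite /gvec !qnormE; qsimp; ring. Qed.

Lemma gvec_dot a b x y : qdot a b (gvec x) (gvec y) = 4%:R * qdot a b x y - qtr x * qtr y.
Proof. rewrite /gvec; qsimp; ring. Qed.

Lemma gvec_vol x y z : vol (gvec x) (gvec y) (gvec z) = 8%:R * vol x y z.
Proof. rewrite /gvec; qsimp; ring. Qed.

(** Lagrange's identity: the cross product of the two Gross vectors is 2[x, y], and its norm is the
    Gram determinant. *)
Lemma gvec_gram a b x y : qnorm a b (gvec x) * qnorm a b (gvec y) - qdot a b (gvec x) (gvec y) ^+ 2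
  = 4%:R * qnorm a b (qcom a b x y).
Proof. rewrite gvec_dot !gvec_norm qcomE !qnormE; qsimp; ring. Qed.

Section GrossBasis.
Context {a b : int} (an : a < 0) (bn : b < 0).

(** What the comparison of two orders uses. The constant 4 is 64/16: passing to Gross vectors
    multiplies [vol] by 8, and 4ab [vol] of the basis is p r up to sign. Then 32 is 8 times 4, from
    the reduction inequality. *)
Definition gross_basis (p r : nat) M (D1 D2 D3 : rat) x1 x2 x3 (g12 g13 g23 : int) : Prop :=
  [/\ subset_q (lat M) (lat (qmat qone x1 x2 x3)), lat M x1, lat M x2 & lat M x3] /\
  [/\ qnorm a b (gvec x1) = D1, qnorm a b (gvec x2) = D2 & qnorm a b (gvec x3) = D3] /\
  [/\ qdot a b (gvec x1) (gvec x2) = g12%:~R, qdot a b (gvec x1) (gvec x3) = g13%:~R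
    & qdot a b (gvec x2) (gvec x3) = g23%:~R] /\
  [/\ `|2%:R * g12%:~R| <= D1, `|2%:R * g13%:~R| <= D1 & `|2%:R * g23%:~R| <= D2] /\
  [/\ exists k : int, D1 * D2 - g12%:~R ^+ 2 = (4 * p%:Z * k)%:~R,
      exists k : int, D1 * D3 - g13%:~R ^+ 2 = (4 * p%:Z * k)%:~R
    & exists k : int, D2 * D3 - g23%:~R ^+ 2 = (4 * p%:Z * k)%:~R] /\
  a%:~R ^+ 2 * b%:~R ^+ 2 * vol (gvec x1) (gvec x2) (gvec x3) ^+ 2 = 4%:R * (p * r)%:R ^+ 2 /\
  3%:R * (D1 * D2 * D3) <= 32%:R * (p * r)%:R ^+ 2.

Lemma gross_basis_exists p r M D1 D2 D3 : is_order a b M -> D1 <= D2 -> D2 <= D3 ->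
  `|4%:R * a%:~R * b%:~R * \det M| = (p * r)%:R ->
  succ_min a b (gross (lat M)) 1 D1 -> succ_min a b (gross (lat M)) 2 D2 ->
  succ_min a b (gross (lat M)) 3 D3 ->
  exists x1 x2 x3 g12 g13 g23, gross_basis p r M D1 D2 D3 x1 x2 x3 g12 g13 g23.
Proof.
move=> oM D12 D23 dM m1 m2 m3.
have [v1 [v2 [v3 [[l1 l2 l3] [[n1 n2 n3] [i3 [g1 g2 g3]]]]]]] := minima_vectors D12 m1 m2 m3.
pose LD x y := @grossD _ x y (@latD M).
have pure x : gross (lat M) x -> x 0 q0 = 0 by exact: gross_pure.
have span := reduced_span an bn LD (@grossZ M) pure l1 l2 l3 n1 n2 n3 i3 D12 D23 g1 g2 g3.
have [b12 b13 b23] := reduced_dot_le LD (@grossZ M) l1 l2 l3 n1 n2 n3 i3 g2 g3.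
have dge := reduced_det_ge an bn LD (@grossZ M) l1 l2 l3 n1 n2 n3 i3 D12 D23 g2 g3.
have gram := gram_det pure l1 l2 l3 n1 n2 n3.
have [x1 [h1 e1]] := l1; have [x2 [h2 e2]] := l2; have [x3 [h3 e3]] := l3.
rewrite -/(gvec x1) in e1; rewrite -/(gvec x2) in e2; rewrite -/(gvec x3) in e3.
subst v1 v2 v3.
have one : lat M qone by case: oM => _ [].
(* A Gross vector determines its source up to a scalar, and a scalar in the order is an integer. *)
have sub : subset_q (lat M) (lat (qmat qone x1 x2 x3)).
  move=> w lw; have [k1 [k2 [k3 e]]] := span (gvec w) (ex_intro _ w (conj lw erefl)).
  pose y := w - (k1%:~R *: x1 + k2%:~R *: x2 + k3%:~R *: x3).
  have ye : y = (y 0 q0) *: qone.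
    have e' : 2%:R *: y = (2%:R * y 0 q0) *: qone.
      have e'' : gvec w - (k1%:~R *: gvec x1 + k2%:~R *: gvec x2 + k3%:~R *: gvec x3) = 0.
        by rewrite e subrr.
      have -> : 2%:R *: y = (gvec w - (k1%:~R *: gvec x1 + k2%:~R *: gvec x2 + k3%:~R *: gvec x3))
         + (2%:R * y 0 q0) *: qone by rewrite /y /gvec; qring.
      by rewrite e'' add0r.
    have n2' : (2%:R : rat) != 0 by [].
    by apply: (scalerI n2'); rewrite e' scalerA.
  have ly : lat M y by apply: latB => //; do !apply: latD; apply: latZ.
  have /intrP [k0 hk] : y 0 q0 \is a Num.int.
    by apply: (order_scalar_int oM); rewrite -ye.
  apply/lat_qmatP; exists k0, k1, k2, k3; rewrite -hk -ye /y.
  by rewrite -!addrA addrA subrK.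
have sub' : subset_q (lat (qmat qone x1 x2 x3)) (lat M).
  by move=> w /lat_qmatP[k0 [k1 [k2 [k3 ->]]]]; do !apply: latD; apply: latZ.
have uM : M \in unitmx by case: oM.
pose N := 4%:R * a%:~R * b%:~R * vol x1 x2 x3.
have aN : `|N| = (p * r)%:R.
  by rewrite -dM /N [LHS]normrM [RHS]normrM (lat_eq_det uM sub sub') det_qmat1.
have N2 : N ^+ 2 = (p * r)%:R ^+ 2 by rewrite -aN real_normK // num_real.
have hvol : a%:~R ^+ 2 * b%:~R ^+ 2 * vol (gvec x1) (gvec x2) (gvec x3) ^+ 2
   = 4%:R * (p * r)%:R ^+ 2 by rewrite -N2 /N gvec_vol; ring.
have dint x y : lat M x -> lat M y -> qdot a b (gvec x) (gvec y) \is a Num.int.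
  move=> hx hy; rewrite gvec_dot; apply: rintB; last by apply: rintM; exact: (order_tr_int oM).
  have -> : 4%:R * qdot a b x y = 2%:R * (2%:R * qdot a b x y) by ring.
  by apply: rintM; [exact: rint_nat|exact: (order_dot_int oM)].
have /intrP [g12 hg12] := dint _ _ h1 h2; have /intrP [g13 hg13] := dint _ _ h1 h3.
have /intrP [g23 hg23] := dint _ _ h2 h3.
have Np (n : int) : exists k : int, 4%:R * (n%:~R * N) = (4 * p%:Z * k)%:~R.
  have [e|e] : N = (p * r)%:R \/ N = - (p * r)%:R.
    by have /eqP := N2; rewrite eqf_sqr => /orP[/eqP|/eqP]; [left|right].
  - exists (n * r%:Z); rewrite e natrM -[p%:R]/(p%:Z%:~R) -[r%:R]/(r%:Z%:~R); ring.
  - exists (- (n * r%:Z)); rewrite e natrM -[p%:R]/(p%:Z%:~R) -[r%:R]/(r%:Z%:~R); ring.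
have k12 : exists k : int, D1 * D2 - g12%:~R ^+ 2 = (4 * p%:Z * k)%:~R.
  rewrite -n1 -n2 -hg12 gvec_gram.
  by have [n ->] := order_com_norm oM sub h1 h2; exact: Np.
have k13 : exists k : int, D1 * D3 - g13%:~R ^+ 2 = (4 * p%:Z * k)%:~R.
  rewrite -n1 -n3 -hg13 gvec_gram.
  have sub3 : subset_q (lat M) (lat (qmat qone x1 x3 x2)).
    move=> w /sub /lat_qmatP[k0 [k1 [k2 [k3 ->]]]]; apply/lat_qmatP.
    by exists k0, k1, k3, k2; rewrite addrAC.
  have [n ->] := order_com_norm oM sub3 h1 h3.
  have -> : 4%:R * a%:~R * b%:~R * vol x1 x3 x2 = - N by rewrite /N; qsimp; ring.
  by have [k hk] := Np (- n); exists k; rewrite -hk rmorphN /= mulrN mulNr.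
have k23 : exists k : int, D2 * D3 - g23%:~R ^+ 2 = (4 * p%:Z * k)%:~R.
  rewrite -n2 -n3 -hg23 gvec_gram.
  have sub3 : subset_q (lat M) (lat (qmat qone x2 x3 x1)).
    move=> w /sub /lat_qmatP[k0 [k1 [k2 [k3 ->]]]]; apply/lat_qmatP.
    by exists k0, k2, k3, k1; rewrite -!addrA; congr (_ + _); rewrite [LHS]addrC -addrA.
  have [n ->] := order_com_norm oM sub3 h2 h3.
  have -> : 4%:R * a%:~R * b%:~R * vol x2 x3 x1 = N by rewrite /N; qsimp; ring.
  exact: Np.
exists x1, x2, x3, g12, g13, g23; split; first by [].
split; first by []. split; first by [].
split; first by rewrite -hg12 -hg13 -hg23.
split; first by []. split; first by [].
move: dge; rewrite gram hvol; lra.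
Qed.

End GrossBasis.

(** The factors g' - g and g' + g have equal parity and a product divisible by 4p, so both are even
    and p divides one of the halves. Each half is at most e/2 < p in absolute value, so that one is
    0. *)
Lemma dot_up_to_sign (p : nat) (d d' e g g' k k' : int) : prime p -> odd p ->
  d * d' - g ^+ 2 = 4 * p%:Z * k -> d * d' - g' ^+ 2 = 4 * p%:Z * k' ->
  `|2 * g| <= e -> `|2 * g'| <= e -> e < 2 * p%:Z -> g' = g \/ g' = - g.
Proof.
move=> pp op h h' b1 b2 ep.
have e1 : (g' - g) * (g' + g) = 4 * p%:Z * (k - k') by rewrite mulrBr -h -h'; ring.
have par : exists j, g' - g = 2 * j.
  have [j [hj|hj]] : exists j, g' - g = 2 * j \/ g' - g = 2 * j + 1.
    by exists ((g' - g) %/ 2)%Z; lia.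
  - by exists j.
  - exfalso; have e2 : g' + g = 2 * (j + g) + 1 by lia.
    have e3 : (2 * j + 1) * (2 * (j + g) + 1) = 2 * (2 * p%:Z * (k - k')) by rewrite -hj -e2 e1; ring.
    have : 2 * (2 * j * (j + g) + j + (j + g)) + 1 = 2 * (2 * p%:Z * (k - k')) by rewrite -e3; ring.
    lia.
have [j hj] := par.
have p2 : ~~ (p%:Z %| 2)%Z.
  rewrite dvdzE /=; apply/negP => h2; have := dvdn_leq (ltn0Sn 1) h2.
  by case: (p) pp op => [|[|[|]]].
have : (p%:Z %| 2 * j * (2 * (j + g)))%Z.
  apply/dvdzP; exists (4 * (k - k')).
  have -> : 2 * (j + g) = g' + g by lia.
  by rewrite -hj e1; ring.
have p0 : 0 < p%:Z by rewrite ltz_nat prime_gt0.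
rewrite !Euclid_dvdzM // (negbTE p2) /= => /orP[/dvdzP[q hq]|/dvdzP[q hq]].
- left; have q0 : q = 0.
    have : `|q| * p%:Z < 1 * p%:Z.
      have -> : `|q| * p%:Z = `|j| by rewrite hq normrM [ `|p%:Z| ]gtr0_norm.
      lia.
    rewrite ltr_pM2r //; lia.
  by move: hq hj; rewrite q0 mul0r; lia.
- right; have q0 : q = 0.
    have : `|q| * p%:Z < 1 * p%:Z.
      have -> : `|q| * p%:Z = `|j + g| by rewrite hq normrM [ `|p%:Z| ]gtr0_norm.
      lia.
    rewrite ltr_pM2r //; lia.
  by move: hq hj; rewrite q0 mul0r; lia.
Qed.

(* If the three signs have product -1, one of x, y, z is 0 and its sign is free. *)
Lemma sign_choice (x y z x' y' z' : int) : x' = x \/ x' = - x -> y' = y \/ y' = - y ->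
  z' = z \/ z' = - z -> x' * y' * z' = x * y * z ->
  exists e1 e2 e3 : int, [/\ e1 ^+ 2 = 1, e2 ^+ 2 = 1 & e3 ^+ 2 = 1] /\
    [/\ e1 * e2 * x' = x, e1 * e3 * y' = y & e2 * e3 * z' = z].
Proof.
have ev (t : int) : t * x * y * z = 0 -> t != 0 -> x = 0 \/ y = 0 \/ z = 0.
  move=> /eqP; rewrite !mulf_eq0 => /orP[/orP[/orP[/eqP ->|/eqP ->]|/eqP ->]|/eqP ->]; auto.
  by rewrite eqxx.
move=> [->|->] [->|->] [->|->] e.
- by exists 1, 1, 1; split; split; ring.
- have [|//|e0|[e0|e0]] := ev 2; first by move: e; rewrite mulrN; lia.
  + by exists (- 1), 1, (- 1); rewrite e0; split; split; ring.
  + by exists 1, 1, (- 1); rewrite e0; split; split; ring.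
  + by exists 1, 1, 1; rewrite e0; split; split; ring.
- have [|//|e0|[e0|e0]] := ev 2; first by move: e; rewrite mulrN mulNr; lia.
  + by exists 1, (- 1), (- 1); rewrite e0; split; split; ring.
  + by exists 1, 1, 1; rewrite e0; split; split; ring.
  + by exists 1, 1, (- 1); rewrite e0; split; split; ring.
- by exists 1, 1, (- 1); split; split; ring.
- have [|//|e0|[e0|e0]] := ev 2; first by move: e; rewrite !mulNr; lia.
  + by exists 1, 1, 1; rewrite e0; split; split; ring.
  + by exists 1, (- 1), (- 1); rewrite e0; split; split; ring.
  + by exists 1, (- 1), 1; rewrite e0; split; split; ring.
- by exists 1, (- 1), 1; split; split; ring.
- by exists (- 1), 1, 1; split; split; ring.
- have [|//|e0|[e0|e0]] := ev 2; first by move: e; rewrite !mulrN !mulNr ?opprK; lia.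
  + by exists 1, 1, (- 1); rewrite e0; split; split; ring.
  + by exists 1, (- 1), 1; rewrite e0; split; split; ring.
  + by exists (- 1), 1, 1; rewrite e0; split; split; ring.
Qed.

(** * From an isometry of determinant 1 to a ring isomorphism *)

Section Isometry.
Context {a b : int} (an : a < 0) (bn : b < 0).

Definition gram_mx : 'M[rat]_4 :=
  diag_mx (\row_i [:: 1; - a%:~R; - b%:~R; a%:~R * b%:~R]`_i).

Lemma qdot_mx x y : qdot a b x y = (x *m gram_mx *m y^T) 0 0.
Proof.
rewrite mxE sum4 /gram_mx !mul_mx_diag !mxE /= /qdot; ring.
Qed.

(** A product is determined by its pairings, and these involve only [vol], [qdot] and 1. A linear
    map preserving all three is therefore multiplicative. *)
Lemma qdot_qmul x y z : qdot a b (qmul a b x y) z = a%:~R * b%:~R * vol x y z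
  + qdot a b x qone * qdot a b y z + qdot a b y qone * qdot a b x z
  - qdot a b x y * qdot a b z qone.
Proof. qsimp; ring. Qed.

Context {v1 v2 v3 u1 u2 u3 : quat}.
Hypotheses (pv1 : v1 0 q0 = 0) (pv2 : v2 0 q0 = 0) (pv3 : v3 0 q0 = 0)
  (pu1 : u1 0 q0 = 0) (pu2 : u2 0 q0 = 0) (pu3 : u3 0 q0 = 0).
Hypotheses (e11 : qnorm a b u1 = qnorm a b v1) (e22 : qnorm a b u2 = qnorm a b v2)
  (e33 : qnorm a b u3 = qnorm a b v3) (e12 : qdot a b u1 u2 = qdot a b v1 v2)
  (e13 : qdot a b u1 u3 = qdot a b v1 v3) (e23 : qdot a b u2 u3 = qdot a b v2 v3).
Hypotheses (ev : vol u1 u2 u3 = vol v1 v2 v3) (ev0 : vol v1 v2 v3 != 0).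

(** Equal Gram matrices make the base change T orthogonal, and equal volumes give det T = 1. The
    defect of multiplicativity is then orthogonal to every zT, so it vanishes because the norm is
    definite. *)
Lemma isometry_qmul : exists T : 'M[rat]_4, [/\ T \in unitmx, qone *m T = qone,
  [/\ v1 *m T = u1, v2 *m T = u2 & v3 *m T = u3]
  & forall x y, qmul a b x y *m T = qmul a b (x *m T) (y *m T)].
Proof.
pose V := qmat qone v1 v2 v3; pose U := qmat qone u1 u2 u3.
have uV : V \in unitmx by rewrite unitmxE unitfE det_qmat1.
have uU : U \in unitmx by rewrite unitmxE unitfE det_qmat1 ev.
have [T VT] : exists T, V *m T = U by exists (invmx V *m U); rewrite mulKVmx.
have dT : \det T = 1.
  have := congr1 determinant VT; rewrite det_mulmx !det_qmat1 ev => h.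
  by apply: (mulfI ev0); rewrite mulr1.
have uT : T \in unitmx by rewrite unitmxE dT unitr1.
have rowT i : row i V *m T = row i U by rewrite -row_mul VT.
have T0 : qone *m T = qone by have := rowT q0; rewrite !row_qmat.
have gramE (A : 'M[rat]_4) i j : (A *m gram_mx *m A^T) i j = qdot a b (row i A) (row j A).
  rewrite qdot_mx -row_mul [LHS]mxE [RHS]mxE; apply: eq_bigr => k _.
  by congr (_ * _); rewrite !mxE.
have VSU : V *m gram_mx *m V^T = U *m gram_mx *m U^T.
  have dC x y : qdot a b x y = qdot a b y x by qsimp; ring.
  have d1 (x : quat) : x 0 q0 = 0 -> qdot a b qone x = 0 by move=> h; qsimp; rewrite h; ring.
  have d1' (x : quat) : x 0 q0 = 0 -> qdot a b x qone = 0 by move=> h; rewrite dC d1.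
  apply/matrixP => i j; rewrite !gramE; move: i j.
  by apply: row4P; apply: row4P; rewrite !row_qmat
    ?(d1 _ pv1, d1 _ pv2, d1 _ pv3, d1 _ pu1, d1 _ pu2, d1 _ pu3)
    ?(d1' _ pv1, d1' _ pv2, d1' _ pv3, d1' _ pu1, d1' _ pu2, d1' _ pu3) -?qnorm_dot //
    ?(dC u2 u1) ?(dC v2 v1) ?(dC u3 u1) ?(dC v3 v1) ?(dC u3 u2) ?(dC v3 v2) //.
have TS : T *m gram_mx *m T^T = gram_mx.
  have VS' : V *m (T *m gram_mx *m T^T) *m V^T = V *m gram_mx *m V^T.
    by rewrite VSU -VT trmx_mul !mulmxA.
  have uVt : V^T \in unitmx by rewrite unitmx_tr.
  by have := can_inj (mulmxK uVt) VS'; exact: (can_inj (mulKmx uV)).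
have dotT x y : qdot a b (x *m T) (y *m T) = qdot a b x y.
  by rewrite !qdot_mx trmx_mul -{2}TS !mulmxA.
have volT x y z : vol (x *m T) (y *m T) (z *m T) = vol x y z.
  rewrite -!det_qmat1.
  have -> : qmat qone (x *m T) (y *m T) (z *m T) = qmat qone x y z *m T.
    by apply/row_matrixP; apply: row4P; rewrite row_mul !row_qmat.
  by rewrite det_mulmx dT mulr1.
exists T; split=> //.
  by have := (rowT q1, rowT q2, rowT q3); rewrite !row_qmat => -[[-> ->] ->].
move=> x y; apply/eqP; rewrite -subr_eq0; apply/eqP.
set w := _ - _; apply: (qnorm_eq0 an bn).
have key z : qdot a b w (z *m T) = 0.
  have dB (s t s' : quat) : qdot a b (s - t) s' = qdot a b s s' - qdot a b t s' by qsimp; ring.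
  have h1 (s : quat) : qdot a b (s *m T) qone = qdot a b s qone by rewrite -{1}T0 dotT.
  by rewrite /w dB dotT !qdot_qmul volT !h1 !dotT subrr.
by rewrite qnorm_dot -{2}(mulmxKV uT w) key.
Qed.

End Isometry.

Lemma int_parity (s : int) : exists k, s = 2 * k \/ s = 2 * k + 1.
Proof. by exists (s %/ 2)%Z; lia. Qed.

Lemma trace_parity (c tx ty nx ny : int) : c ^+ 2 = 1 ->
  4 * nx - tx ^+ 2 = 4 * ny - ty ^+ 2 -> exists k, tx - c * ty = 2 * k.
Proof.
move=> hc hp; have [k [hk|hk]] := int_parity (tx - c * ty); first by exists k.
have e : tx = 2 * k + 1 + c * ty by rewrite -hk subrK.
have : tx ^+ 2 = 2 * (2 * k ^+ 2 + 2 * k + (2 * k + 1) * (c * ty)) + 1 + c ^+ 2 * ty ^+ 2.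
  by rewrite e; ring.
rewrite hc mul1r; move: hp; move: (tx ^+ 2) (ty ^+ 2) (2 * k ^+ 2 + _ + _).
by move=> u v w; clear; lia.
Qed.

Lemma orders_iso_of_gross_basis (a b : int) (p r : nat) M1 M2 D1 D2 D3 x1 x2 x3 g12 g13 g23
    y1 y2 y3 h12 h13 h23 : a < 0 -> b < 0 -> prime p -> odd p ->
  is_order a b M1 -> is_order a b M2 -> (0 < r)%N ->
  @gross_basis a b p r M1 D1 D2 D3 x1 x2 x3 g12 g13 g23 ->
  @gross_basis a b p r M2 D1 D2 D3 y1 y2 y3 h12 h13 h23 ->
  D1 <= D2 -> D2 <= D3 -> 8%:R * r%:R ^+ 2 <= D1 ->
  orders_iso a b (lat M1) (lat M2).
Proof.
move=> an bn pp op o1 o2 r0.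
case=> [[sx lx1 lx2 lx3] [[n1 n2 n3] [[d12 d13 d23] [[b12 b13 b23] [[k12 k13 k23] [vx le]]]]]].
case=> [[sy ly1 ly2 ly3] [[m1 m2 m3] [[e12 e13 e23] [[c12 c13 c23] [[j12 j13 j23] [vy _]]]]]].
move=> D12 D23 D1r.
have p0 : (0 : rat) < p%:R by rewrite ltr0n prime_gt0.
have rr0 : (0 : rat) < r%:R by rewrite ltr0n.
have D1pos : 0 < D1 by apply: lt_le_trans D1r; rewrite mulr_gt0 // exprn_gt0.
(* This is where 8 comes from: 3 D1 D2^2 <= 32 p^2 r^2 = 4 p^2 (8 r^2) <= 4 p^2 D1, so 3 D2^2 <= 4
   p^2. *)
have D2p : D2 < 2%:R * p%:R.
  have h1 : 3%:R * (D1 * (D2 * D2)) <= 4%:R * (p%:R ^+ 2 * D1).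
    have q1 : D1 * (D2 * D2) <= D1 * D2 * D3.
      rewrite mulrA; apply: ler_wpM2l => //; apply: mulr_ge0; lra.
    have q2 : p%:R ^+ 2 * (8%:R * r%:R ^+ 2) <= p%:R ^+ 2 * D1.
      by apply: ler_wpM2l => //; exact: sqr_ge0.
    move: le; rewrite natrM exprMn; lra.
  have h2 : 3%:R * D2 ^+ 2 <= 4%:R * p%:R ^+ 2.
    by rewrite -(ler_pM2l D1pos) expr2; move: h1; lra.
  rewrite ltNge; apply/negP => h3.
  have : (2%:R * p%:R) ^+ 2 <= D2 ^+ 2 by rewrite lerXn2r // nnegrE; lra.
  have : (0 : rat) < p%:R ^+ 2 by rewrite exprn_gt0.
  rewrite exprMn; lra.
have Dint x D : lat M1 x -> qnorm a b (gvec x) = D -> D \is a Num.int.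
  move=> lx <-; rewrite gvec_norm; apply: rintB.
    by apply: rintM; [exact: rint_nat|exact: (order_norm_int o1)].
  by apply: rintX; exact: (order_tr_int o1).
have /intrP [d1 hd1] := Dint _ _ lx1 n1; have /intrP [d2 hd2] := Dint _ _ lx2 n2.
have /intrP [d3 hd3] := Dint _ _ lx3 n3.
have toZ (x y g : int) : (exists k : int, x%:~R * y%:~R - g%:~R ^+ 2 = (4 * p%:Z * k)%:~R :> rat) ->
    exists k, x * y - g ^+ 2 = 4 * p%:Z * k.
  have e : (x * y - g ^+ 2)%:~R = x%:~R * y%:~R - g%:~R ^+ 2 :> rat by ring.
  by case=> k hk; exists k; apply/eqP; rewrite -(eqr_int rat) e hk.
have toZle (g d : int) : `|2%:R * g%:~R| <= d%:~R :> rat -> `|2 * g| <= d.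
  have e : (2 * g)%:~R = 2%:R * g%:~R :> rat by ring.
  by move=> h; rewrite -(ler_int rat) intr_norm e.
have d2p : d2 < 2 * p%:Z.
  have e : (2 * p%:Z)%:~R = 2%:R * p%:R :> rat by rewrite -[p%:R]/(p%:Z%:~R); ring.
  by rewrite -(ltr_int rat) e -hd2.
have d1p : d1 < 2 * p%:Z.
  by apply: le_lt_trans d2p; rewrite -(ler_int rat) -hd1 -hd2.
have s12 : h12 = g12 \/ h12 = - g12.
  rewrite hd1 hd2 in k12 j12; rewrite hd1 in b12 c12.
  have [k hk] := toZ _ _ _ k12; have [j hj] := toZ _ _ _ j12.
  exact: (dot_up_to_sign pp op hk hj (toZle _ _ b12) (toZle _ _ c12) d1p).
have s13 : h13 = g13 \/ h13 = - g13.
  rewrite hd1 hd3 in k13 j13; rewrite hd1 in b13 c13.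
  have [k hk] := toZ _ _ _ k13; have [j hj] := toZ _ _ _ j13.
  exact: (dot_up_to_sign pp op hk hj (toZle _ _ b13) (toZle _ _ c13) d1p).
have s23 : h23 = g23 \/ h23 = - g23.
  rewrite hd2 hd3 in k23 j23; rewrite hd2 in b23 c23.
  have [k hk] := toZ _ _ _ k23; have [j hj] := toZ _ _ _ j23.
  exact: (dot_up_to_sign pp op hk hj (toZle _ _ b23) (toZle _ _ c23) d2p).
have pure x : gvec x 0 q0 = 0 by rewrite /gvec; qsimp; ring.
have gd x y z := gram_det (a := a) (b := b) (Lam := fun v => v 0 q0 = 0) (fun v h => h)
  (pure x) (pure y) (pure z) erefl erefl erefl.
(* The two Gram determinants are equal, and all their terms agree except possibly twice the triple
   product. *)
have prod_eq : h12 * h13 * h23 = g12 * g13 * g23.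
  have := gd y1 y2 y3; rewrite vy -vx -gd m1 m2 m3 n1 n2 n3 d12 d13 d23 e12 e13 e23.
  have sq (g h : int) : h = g \/ h = - g -> (h%:~R : rat) ^+ 2 = g%:~R ^+ 2.
    by case=> ->; rewrite ?rmorphN ?sqrrN.
  rewrite (sq _ _ s12) (sq _ _ s13) (sq _ _ s23) => h.
  apply: (intr_inj (R := rat)); rewrite !intrM; move: h; lra.
have [f1 [f2 [f3 [[q1 q2 q3] [t12 t13 t23]]]]] := sign_choice s12 s13 s23 prod_eq.
have vv : vol (gvec y1) (gvec y2) (gvec y3) ^+ 2 = vol (gvec x1) (gvec x2) (gvec x3) ^+ 2.
  have ab0 : (a%:~R ^+ 2 * b%:~R ^+ 2 : rat) != 0.
    by rewrite mulf_neq0 // expf_neq0 // intr_eq0 lt_eqF.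
  by apply: (mulfI ab0); rewrite vx vy.
have volZ (c1 c2 c3 : rat) u v w : vol (c1 *: u) (c2 *: v) (c3 *: w) = c1 * c2 * c3 * vol u v w.
  qsimp; ring.
have dotZ (c d : rat) u v : qdot a b (c *: u) (d *: v) = c * d * qdot a b u v.
  qsimp; ring.
(* The overall sign is free: changing it for all three vectors fixes the Gram matrix and flips the orientation *)
have [f hf hvol] : exists2 f : int, f ^+ 2 = 1 &
    vol ((f * f1)%:~R *: gvec y1) ((f * f2)%:~R *: gvec y2) ((f * f3)%:~R *: gvec y3)
    = vol (gvec x1) (gvec x2) (gvec x3).
  have /eqP : (f1 * f2 * f3)%:~R ^+ 2 * vol (gvec y1) (gvec y2) (gvec y3) ^+ 2
      = vol (gvec x1) (gvec x2) (gvec x3) ^+ 2 :> rat.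
    rewrite -vv -rmorphXn /= !exprMn q1 q2 q3; ring.
  rewrite -exprMn eqf_sqr => /orP[/eqP h|/eqP h]; [exists 1 => //|exists (- 1) => //];
    rewrite volZ; [rewrite -h|rewrite -[RHS]opprK -h]; ring.
have ff1 : (f * f1) ^+ 2 = 1 by rewrite exprMn hf q1.
have ff2 : (f * f2) ^+ 2 = 1 by rewrite exprMn hf q2.
have ff3 : (f * f3) ^+ 2 = 1 by rewrite exprMn hf q3.
have normZ (c : int) u : c ^+ 2 = 1 -> qnorm a b (c%:~R *: u) = qnorm a b u.
  by move=> hc; rewrite !qnorm_dot dotZ -intrM -expr2 hc mul1r.
have dd (c1 c2 g h : int) : c1 * c2 * h = g -> (f * c1)%:~R * (f * c2)%:~R * h%:~R = g%:~R :> rat.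
  by move=> <-; rewrite -!intrM; congr (_%:~R); rewrite mulrACA -expr2 hf mul1r.
have ev0 : vol (gvec x1) (gvec x2) (gvec x3) != 0.
  apply/negP => /eqP h; move: vx; rewrite h expr0n /= mulr0 natrM.
  have : 0 < (p%:R * r%:R : rat) ^+ 2 by rewrite exprn_gt0 // mulr_gt0.
  lra.
have pureZ (c : rat) x : (c *: gvec x) 0 q0 = 0 by rewrite scaleqE pure mulr0.
have [T [uT T0 [T1 T2 T3] Tm]] := isometry_qmul an bn (pure x1) (pure x2) (pure x3)
  (pureZ (f * f1)%:~R y1) (pureZ (f * f2)%:~R y2) (pureZ (f * f3)%:~R y3)
  (etrans (normZ _ _ ff1) (etrans m1 (esym n1)))
  (etrans (normZ _ _ ff2) (etrans m2 (esym n2)))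
  (etrans (normZ _ _ ff3) (etrans m3 (esym n3)))
  (etrans (dotZ _ _ _ _) (etrans (congr1 _ e12) (etrans (dd _ _ _ _ t12) (esym d12))))
  (etrans (dotZ _ _ _ _) (etrans (congr1 _ e13) (etrans (dd _ _ _ _ t13) (esym d13))))
  (etrans (dotZ _ _ _ _) (etrans (congr1 _ e23) (etrans (dd _ _ _ _ t23) (esym d23)))) hvol ev0.
have one1 : lat M1 qone by case: o1 => _ [].
have one2 : lat M2 qone by case: o2 => _ [].
(* The trace is determined modulo 2 by the norm of the Gross vector, so T shifts by integers only *)
have step x y (c : int) : lat M1 x -> lat M2 y -> c ^+ 2 = 1 ->
    qnorm a b (gvec x) = qnorm a b (gvec y) -> gvec x *m T = c%:~R *: gvec y ->
    exists k : int, x *m T = c%:~R *: y + k%:~R *: qone.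
  move=> lx ly hc hn hT.
  have /intrP [tx htx] := order_tr_int o1 lx; have /intrP [ty hty] := order_tr_int o2 ly.
  have /intrP [nx hnx] := order_norm_int o1 lx; have /intrP [ny hny] := order_norm_int o2 ly.
  have hp : 4 * nx - tx ^+ 2 = 4 * ny - ty ^+ 2.
    apply/eqP; rewrite -(eqr_int rat); apply/eqP.
    move: hn; rewrite !gvec_norm htx hty hnx hny => hn.
    transitivity (4%:R * nx%:~R - tx%:~R ^+ 2 : rat); first ring.
    rewrite hn; ring.
  have [k hk] := trace_parity hc hp.
  exists k.
  have hx2 : 2%:R *: (x *m T) = 2%:R *: (c%:~R *: y + k%:~R *: qone).
    have ex : 2%:R *: x = gvec x + tx%:~R *: qone by rewrite /gvec htx subrK.
    rewrite scalemxAl ex mulmxDl -scalemxAl T0 hT /gvec hty.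
    have -> : tx = 2 * k + c * ty by rewrite -hk subrK.
    qring.
  have n20 : (2%:R : rat) != 0 by [].
  exact: (scalerI n20 hx2).
have [k1 hk1] := step _ _ _ lx1 ly1 ff1 (etrans n1 (esym m1)) T1.
have [k2 hk2] := step _ _ _ lx2 ly2 ff2 (etrans n2 (esym m2)) T2.
have [k3 hk3] := step _ _ _ lx3 ly3 ff3 (etrans n3 (esym m3)) T3.
have inv x y (c k : int) : lat M1 x -> c ^+ 2 = 1 -> x *m T = c%:~R *: y + k%:~R *: qone ->
    exists z, lat M1 z /\ z *m T = y.
  move=> lx hc hx; exists (c%:~R *: (x - k%:~R *: qone)); split.
    by apply: latZ; apply: latB => //; exact: latZ.
  rewrite -scalemxAl mulmxBl hx -scalemxAl T0 addrK scalerA -intrM -expr2 hc.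
  exact: scale1r.
exists (fun x => x *m T); split; last split; last split; last split; last split.
- move=> x /sx /lat_qmatP[i0 [i1 [i2 [i3 ->]]]].
  rewrite !mulmxDl -!scalemxAl T0 hk1 hk2 hk3.
  have mem (y : quat) (i c k : int) : lat M2 y ->
      lat M2 (i%:~R *: (c%:~R *: y + k%:~R *: qone)).
    by move=> ly; apply: latZ; apply: latD; apply: latZ.
  by apply: latD; [apply: latD; [apply: latD; [exact: latZ|]|]|]; exact: mem.
- move=> y /sy /lat_qmatP[i0 [i1 [i2 [i3 ->]]]].
  have [z1 [lz1 hz1]] := inv _ _ _ _ lx1 ff1 hk1.
  have [z2 [lz2 hz2]] := inv _ _ _ _ lx2 ff2 hk2.
  have [z3 [lz3 hz3]] := inv _ _ _ _ lx3 ff3 hk3.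
  exists (i0%:~R *: qone + i1%:~R *: z1 + i2%:~R *: z2 + i3%:~R *: z3); split.
    by do !apply: latD; apply: latZ.
  by rewrite !mulmxDl -!scalemxAl T0 hz1 hz2 hz3.
- by move=> x y _ _ /(can_inj (mulmxK uT)).
- by move=> x y _ _; exact: mulmxDl.
- by move=> x y _ _; exact: Tm.
- exact: T0.
Qed.

Theorem theorem1p3 (p : nat) (a b : int) (r : nat)
    (M1 M2 Mmax1 Mmax2 : 'M[rat]_4) (D1 D2 D3 : rat) :
  prime p -> odd p ->
  ramified_exactly_at_p_infty a b p ->
  is_order a b M1 -> is_order a b M2 ->
  is_max_order a b Mmax1 -> is_max_order a b Mmax2 ->
  index_is (lat M1) (lat Mmax1) r ->
  index_is (lat M2) (lat Mmax2) r ->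
  D1 <= D2 -> D2 <= D3 ->
  succ_min a b (gross (lat M1)) 1 D1 ->
  succ_min a b (gross (lat M1)) 2 D2 ->
  succ_min a b (gross (lat M1)) 3 D3 ->
  succ_min a b (gross (lat M2)) 1 D1 ->
  succ_min a b (gross (lat M2)) 2 D2 ->
  succ_min a b (gross (lat M2)) 3 D3 ->
  8%:R * (r%:R) ^+ 2 <= D1 ->
  orders_iso a b (lat M1) (lat M2).
Proof.
move=> pp op ram o1 o2 mo1 mo2 i1 i2 D12 D23 s1 s2 s3 t1 t2 t3 D1r.
have [an [bn _]] := ram.
have a0 : a != 0 by rewrite lt_eqF.
have b0 : b != 0 by rewrite lt_eqF.
have det_eq M Mmax : is_order a b M -> is_max_order a b Mmax -> index_is (lat M) (lat Mmax) r ->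
    `|4%:R * a%:~R * b%:~R * \det M| = (p * r)%:R.
  move=> [uM _] mo hi; have uX : Mmax \in unitmx by case: mo => [[]].
  rewrite natrM -(max_order_disc a0 b0 pp op ram mo).
  by rewrite !(normrM _ (\det _)) (index_det uM uX hi) mulrCA mulrC.
(* The coset of 0 needs a representative, so the list is not empty. *)
have r0 : (0 < r)%N.
  case: i1 => _ [s [_ [_ [_ /(_ 0 (lat0 _)) [i]]]]].
  by case: (r).
have [x1 [x2 [x3 [g12 [g13 [g23 hx]]]]]] :=
  gross_basis_exists an bn o1 D12 D23 (det_eq _ _ o1 mo1 i1) s1 s2 s3.
have [y1 [y2 [y3 [h12 [h13 [h23 hy]]]]]] :=
  gross_basis_exists an bn o2 D12 D23 (det_eq _ _ o2 mo2 i2) t1 t2 t3.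
exact: (orders_iso_of_gross_basis an bn pp op o1 o2 r0 hx hy D12 D23 D1r).
Qed.
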